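(* Let $\Omega$ be convex. Let $j$ and $\nabla_R j$ be bounded on the unit ball of $L^\infty(\Omega)$. Let $(w^n)_n \subset \{ w \in H^1(\Omega) \mid 0 \le w(x) \le 1 \text{ for a.e. } x \in \Omega\}$ be the sequence of iterates produced by the homotopy trust-region algorithm (described in the context), with associated parameters $(\varepsilon^n)_n$. Then there exist $C > 0$ and a subsequence $(w^{n_k})_k$ of $(w^n)_n$ such that $$\sup_{k \in \mathbb{N}} \; j(w^{n_k}) + \gamma E_{\varepsilon^{n_k}}(w^{n_k}) < C < \infty .$$
   Context: $\Omega \subset \mathbb{R}^d$, $d \in \{2,3\}$, is a bounded Lipschitz domain and $\gamma > 0$. The function $j : L^2(\Omega)\to\mathbb{R}$ is Fréchet differentiable and $\nabla_R j(w)\in L^2(\Omega)$ is the Riesz representative of $j'(w)$; boundedness of $\nabla_R j$ on the unit ball of $L^\infty(\Omega)$ means $\sup\{\|\nabla_R j(w)\|_{L^2(\Omega)} : \|w\|_{L^\infty(\Omega)}\le 1\}<\infty$. Energy: for $\varepsilon>0$, $E_\varepsilon(w) = \int_\Omega \frac{\varepsilon}{2}|\nabla w|^2 + \frac1\varepsilon \Psi(w)\,\mathrm{d}x$ if $w \in H^1(\Omega)$ and $E_\varepsilon(w) = \infty$ otherwise, where $\Psi(w)(x) = w(x)(1-w(x))$ if $w(x)\in[0,1]$ and $\Psi(w)(x)=\infty$ otherwise. Trust-region subproblems: for $\bar w \in H^1(\Omega)$ with values in $[0,1]$ a.e., $g \in L^2(\Omega)$, $\Delta > 0$, both minimize over $w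 \in L^2(\Omega)$ subject to $\|w-\bar w\|_{L^2(\Omega)}^2 \le \Delta$ and $w(x)\in[0,1]$ for a.e. $x\in\Omega$. - $(\mathrm{TR}_\varepsilon)(\bar w,g,\Delta)$ has objective $(g,w-\bar w)_{L^2(\Omega)} + \gamma E_\varepsilon(w) - \gamma E_\varepsilon(\bar w)$. - $(\mathrm{TR}^c_\varepsilon)(\bar w,g,\Delta)$ has objective $\left(g + \frac{\gamma}{\varepsilon}(1-2\bar w), w-\bar w\right)_{L^2(\Omega)} + \gamma\frac{\varepsilon}{2}\|\nabla w\|_{L^2(\Omega)}^2 - \gamma\frac\varepsilon2\|\nabla\bar w\|_{L^2(\Omega)}^2$ (equal to $+\infty$ for $w \notin H^1(\Omega)$). Reductions: $\operatorname{ared}(w,v,\varepsilon) = j(w)+\gamma E_\varepsilon(w) - j(v) - \gamma E_\varepsilon(v)$; $\operatorname{pred}(w,\Delta,\varepsilon)$ is minus the minimal objective value of $(\mathrm{TR}^c_\varepsilon)(w,\nabla_R j(w),\Delta)$ if flag $=1$, and minus the minimal objective value of $(\mathrm{TR}_\varepsilon)(w,\nabla_R j(w),\Delta)$ if flag $=0$. Homotopy trust-region algorithm. Inputs: $\rho\in(0,1)$, $\Delta^0>0$, $\varepsilon^0>0$, $r>4$, $0<\kappa^0<\rho$, $\underline\Delta^0\in(0,\Delta^0)$, $w^0\in H^1(\Omega)$ with values in $\{0,1\}$ a.e. Set flag $=1$. For $n=0,1,2,\dots$: (1) If flag $=1$, let $\tilde w^n$ be a minimizer of $(\mathrm{TR}^c_{\varepsilon^n})(w^n,\nabla_R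 j(w^n),\Delta^n)$; otherwise let $\tilde w^n$ be a minimizer of $(\mathrm{TR}_{\varepsilon^n})(w^n,\nabla_R j(w^n),\Delta^n)$. (2) If $\operatorname{ared}(w^n,\tilde w^n,\varepsilon^n)\ge\rho\operatorname{pred}(w^n,\Delta^n,\varepsilon^n)$ and $\operatorname{ared}(w^n,\tilde w^n,\varepsilon^n)>\kappa^n\underline\Delta^n$ (acceptance), set $w^{n+1}=\tilde w^n$, $\Delta^{n+1}=\min\{\Delta^0,2\Delta^n\}$, flag $=1$. Otherwise set $w^{n+1}=w^n$, $\Delta^{n+1}=\Delta^n/2$. (3) If $\Delta^{n+1}<\underline\Delta^n$ and flag $=1$: set flag $=0$, reset $\Delta^{n+1}=\Delta^0$, and keep $\underline\Delta^{n+1}=\underline\Delta^n$, $\varepsilon^{n+1}=\varepsilon^n$, $\kappa^{n+1}=\kappa^n$. Else if $\Delta^{n+1}<\underline\Delta^n$: set flag $=1$, $\Delta^{n+1}=\Delta^0$, $\underline\Delta^{n+1}=\underline\Delta^n/2$, $\varepsilon^{n+1}=\varepsilon^n/r$, $\kappa^{n+1}=\kappa^n/2$. Otherwise keep $\underline\Delta^{n+1}=\underline\Delta^n$, $\varepsilon^{n+1}=\varepsilon^n$, $\kappa^{n+1}=\kappa^n$. *)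

(* Defs.v *)
From HB Require Import structures.
From mathcomp Require Import all_boot all_order all_algebra.
From mathcomp Require Import all_classical all_reals all_analysis.
From mathcomp Require Import measurable_realfun.
Set Implicit Arguments. Unset Strict Implicit. Unset Printing Implicit Defensive.
Import Order.TTheory GRing.Theory Num.Theory.
Import numFieldNormedType.Exports.
Local Open Scope classical_set_scope.
Local Open Scope ring_scope.

Fact rV_display : measure_display.
Proof. exact: default_measure_display. Qed.

(* The Borel sigma-algebra of R^n, generated by the coordinate maps. *)
Section measurable_rV.
Variables (R : realType) (n : nat).

Let coord (i : 'I_n) (x : 'rV[R]_n) : R := x 0 i.

Let rV_set0 : g_sigma_preimage coord set0.
Proof. exact: sigma_algebra0. Qed.

Let rV_setC A : g_sigma_preimage coord A -> g_sigma_preimage coord (~` A).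
Proof. exact: sigma_algebraC. Qed.

Let rV_bigcup (F : _^nat) : (forall i, g_sigma_preimage coord (F i)) ->
  g_sigma_preimage coord (\bigcup_i (F i)).
Proof. exact: sigma_algebra_bigcup. Qed.

HB.instance Definition _ := @isMeasurable.Build rV_display
  'rV[R]_n (g_sigma_preimage coord) rV_set0 rV_setC rV_bigcup.

Lemma measurable_coord (i : 'I_n) :
  measurable_fun [set: 'rV[R]_n] (fun x : 'rV[R]_n => x 0 i).
Proof.
move=> _ Y mY; rewrite setTI; apply: sub_sigma_algebra => /=.
rewrite -bigcup_seq/=; exists i => /=; first by rewrite mem_index_enum.
by exists Y => //; rewrite setTI.
Qed.

Lemma measurable_fun_rV d (T : measurableType d) (f : T -> 'rV[R]_n) :
  (forall i, measurable_fun [set: T] (fun t => f t 0 i)) ->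
  measurable_fun [set: T] f.
Proof.
move=> mf.
have H : g_sigma_preimage (fun i => coord i \o f) `<=` measurable.
  apply: smallest_sub; first exact: sigma_algebra_measurable.
  rewrite -bigcup_seq; apply: bigcup_sub => i _.
  by move=> A [B mB <-]; exact: mf.
rewrite g_sigma_preimage_comp in H.
by move=> _ A mA; apply: H; exists A.
Qed.

Lemma open_measurable_rV (U : set 'rV[R]_n) : open U -> measurable U.
Proof.
move=> oU.
pose F (qk : {ffun 'I_n -> rat} * nat) : set 'rV[R]_n :=
  [set x | forall i, `|x 0 i - ratr (qk.1 i)| < qk.2.+1%:R^-1].
have mF qk : measurable (F qk).
  rewrite (_ : F qk = \bigcap_i
     [set x : 'rV[R]_n | `|x 0 i - ratr (qk.1 i)| < qk.2.+1%:R^-1]); last first.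
    by apply/seteqP; split => x /=; [move=> h i _; exact: h | move=> h i; exact: h].
  apply: fin_bigcap_measurable; first exact: finite_finset.
  move=> i _.
  rewrite -[X in measurable X]setTI.
  have -> : [set x : 'rV[R]_n | `|x 0 i - ratr (qk.1 i)| < qk.2.+1%:R^-1] =
    (fun x : 'rV[R]_n => x 0 i) @^-1` (ball (ratr (qk.1 i) : R) qk.2.+1%:R^-1).
    by apply/seteqP; split=> x /=; rewrite -ball_normE /ball_/= distrC.
  apply: measurable_coord => //; exact: measurable_ball.
pose G qk := if `[< F qk `<=` U >] then F qk else set0.
have -> : U = \bigcup_qk G qk.
  apply/seteqP; split => [x Ux|x [qk _]]; last first.
    by rewrite /G; case: asboolP => // FU /FU.
  have /nbhs_ballP[e /= e0 xeU] : nbhs x U by exact: open_nbhs_nbhs.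
  have [k ke] : exists k : nat, k.+1%:R^-1 < e / 2.
    have e20 : 0 < e / 2 by rewrite divr_gt0.
    have [k _ hk] := near_infty_natSinv_lt (PosNum e20).
    by exists k; exact: hk k (leqnn k).
  have qP i : exists q : rat, `|x 0 i - ratr q| < k.+1%:R^-1.
    have [|q] := @rat_in_itvoo R (x 0 i - k.+1%:R^-1) (x 0 i + k.+1%:R^-1).
      by rewrite ltrD2l gt0_cp// invr_gt0.
    by rewrite in_itv/= => qx; exists q; rewrite distrC ltr_distl.
  have [q Hq] := choice qP.
  exists ([ffun i => q i], k) => //; rewrite /G.
  case: asboolP => [_ i|[]] /=; first by rewrite ffunE; exact: Hq.
  move=> y Fy; apply: xeU; split=> [|i j]; [exact: e0|rewrite ord1].
  have := Fy j; rewrite /= ffunE => yq.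
  rewrite -ball_normE /ball_ /=.
  rewrite (le_lt_trans (ler_distD (ratr (q j)) _ _))// (splitr e) ltrD//.
    exact: lt_trans (Hq j) ke.
  by rewrite distrC (lt_trans yq).
apply: countable_bigcupT_measurable => [|qk]; first exact: countableP.
by rewrite /G; case: asboolP.
Qed.

End measurable_rV.

Section lebesgue_rV.
Variable R : realType.

Definition rV_cons n (p : R * 'rV[R]_n) : 'rV[R]_n.+1 :=
  row_mx (p.1)%:M p.2.

Lemma measurable_rV_cons n : measurable_fun [set: R * 'rV[R]_n] (@rV_cons n).
Proof.
apply: measurable_fun_rV => i.
rewrite /rV_cons.
have [j ->|j ->] := @split_ordP 1 n i.
  under eq_fun do rewrite (@row_mxEl _ 1 1 n) mxE !ord1 eqxx mulr1n.
  exact: measurable_fst.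
under eq_fun do rewrite (@row_mxEr _ 1 1 n).
exact: (measurableT_comp (measurable_coord j)).
Qed.

Section step.
Variables (n : nat) (mu : {sigma_finite_measure set 'rV[R]_n -> \bar R}).

Definition lebesgue_rV_step : set 'rV[R]_n.+1 -> \bar R :=
  pushforward (@lebesgue_measure R \x mu)%E (@rV_cons n).

HB.instance Definition _ := Measure.copy lebesgue_rV_step
  (measure_function_pushforward__canonical__measure_function_Measure
    (@lebesgue_measure R \x mu)%E (@measurable_rV_cons n)).

Let sigma_finite_step : sigma_finite setT lebesgue_rV_step.
Proof.
pose g (x : 'rV[R]_n.+1) : R * 'rV[R]_n :=
  (x 0 ord0, \row_i x 0 (lift ord0 i)).
have gK : cancel (@rV_cons n) g.
  move=> [a v]; rewrite /g /rV_cons /=; congr pair.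
    rewrite (_ : ord0 = @lshift 1 n ord0); last exact/val_inj.
    by rewrite (@row_mxEl _ 1 1 n) mxE eqxx mulr1n.
  apply/rowP => i; rewrite mxE.
  rewrite (_ : lift ord0 i = @rshift 1 n i); last exact/val_inj.
  by rewrite (@row_mxEr _ 1 1 n).
have mg : measurable_fun setT g.
  apply/measurable_fun_pairP; split; first exact: measurable_coord.
  apply: measurable_fun_rV => i /=.
  under eq_fun do rewrite mxE.
  exact: measurable_coord.
have /sigma_finiteP[F [TF ndF Foo]] := sigma_finiteT (@lebesgue_measure R).
have /sigma_finiteP[G [TG ndG Goo]] := sigma_finiteT mu.
exists (fun i => g @^-1` (F i `*` G i)).
  apply/seteqP; split => // x _.
  have [k _ Fk] : (\bigcup_i F i) (g x).1 by rewrite -TF.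
  have [l _ Gl] : (\bigcup_i G i) (g x).2 by rewrite -TG.
  exists (maxn k l) => //; split.
  - by move: Fk; exact/subsetPset/ndF/leq_maxl.
  - by move: Gl; exact/subsetPset/ndG/leq_maxr.
move=> k; have [mFk Fk] := Foo k; have [mGk Gk] := Goo k; split.
  by rewrite -[X in measurable X]setTI; apply: mg => //; exact: measurableX.
rewrite /lebesgue_rV_step /pushforward -comp_preimage (_ : g \o _ = id); last first.
  by apply/funext => x /=; rewrite gK.
by rewrite preimage_id product_measure1E// lte_mul_pinfty// ge0_fin_numE.
Qed.

HB.instance Definition _ := @Measure_isSigmaFinite.Build _ _ _ lebesgue_rV_step
  sigma_finite_step.

End step.

(* Lebesgue measure on R^n, as the n-fold product of the one-dimensional one;
   see [lebesgue_rV_box]. *)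
Fixpoint lebesgue_rV (n : nat) : {sigma_finite_measure set 'rV[R]_n -> \bar R} :=
  match n with
  | 0 => \d_(0 : 'rV[R]_0)
  | m.+1 => lebesgue_rV_step (lebesgue_rV m)
  end.

Lemma lebesgue_rV_box n (a b : 'rV[R]_n) : (forall i, a 0 i <= b 0 i) ->
  lebesgue_rV n [set x | forall i, a 0 i <= x 0 i <= b 0 i] =
  (\prod_(i < n) (b 0 i - a 0 i))%:E.
Proof.
elim: n a b => [|n IH] a b ab.
  by rewrite big_ord0 /= diracE mem_set//; case.
pose tl (x : 'rV[R]_n.+1) : 'rV[R]_n := \row_i x 0 (lift ord0 i).
pose B (c : 'rV[R]_n) (e : 'rV[R]_n) : set 'rV[R]_n :=
  [set x | forall i, c 0 i <= x 0 i <= e 0 i].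
have mB c e : measurable (B c e).
  rewrite (_ : B c e =
      \bigcap_i [set x : 'rV[R]_n | x 0 i \in `[c 0 i, e 0 i]]); last first.
    apply/seteqP; split => x /= Bx i; first by move=> _; rewrite /= in_itv/= Bx.
    by have := Bx i Logic.I; rewrite /= in_itv.
  apply: fin_bigcap_measurable => [|i _]; first exact: finite_finset.
  rewrite -[X in measurable X]setTI.
  have -> : [set x : 'rV[R]_n | x 0 i \in `[c 0 i, e 0 i]] =
    (fun x : 'rV[R]_n => x 0 i) @^-1` `[c 0 i, e 0 i]%classic by [].
  by apply: measurable_coord => //; exact: measurable_itv.
transitivity ((@lebesgue_measure R \x lebesgue_rV n)%E
    (`[a 0 0, b 0 0]%classic `*` B (tl a) (tl b))).
  rewrite /= /lebesgue_rV_step /pushforward; congr (_ _).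
  have E0 (p : R * 'rV[R]_n) : rV_cons p 0 ord0 = p.1.
    rewrite /rV_cons (_ : ord0 = @lshift 1 n ord0); last exact/val_inj.
    by rewrite (@row_mxEl _ 1 1 n) mxE eqxx mulr1n.
  have ES (p : R * 'rV[R]_n) i : rV_cons p 0 (lift ord0 i) = p.2 0 i.
    rewrite /rV_cons (_ : lift ord0 i = @rshift 1 n i); last exact/val_inj.
    by rewrite (@row_mxEr _ 1 1 n).
  apply/seteqP; split => -[t v] /=.
    move=> H; split; first by rewrite in_itv/=; have := H ord0; rewrite E0.
    by move=> i; rewrite !mxE; have := H (lift ord0 i); rewrite ES.
  move=> [Ht Hv] i; have [j ->|->] := unliftP ord0 i.
    by rewrite ES; have := Hv j; rewrite !mxE.
  by rewrite E0; move: Ht; rewrite in_itv.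
rewrite product_measure1E//.
rewrite [X in (_ * X)%E]IH; last by move=> i; rewrite !mxE.
have {}ab0 : @lebesgue_measure R `[a 0 0, b 0 0]%classic = (b 0 0 - a 0 0)%:E.
  rewrite lebesgue_measure_itv /= lte_fin; case: ltP => // ba.
  by rewrite (@le_anti _ _ (a 0 0) (b 0 0)) ?subrr// ab ba.
rewrite [X in (X * _)%E]ab0 big_ord_recl EFinM; congr (_ * _%:E)%E.
by apply: eq_bigr => i _; rewrite !mxE.
Qed.

End lebesgue_rV.

Section domain.
Variables (R : realType) (d : nat).

(* After an orthogonal change of coordinates, Omega is near each of its boundary
   points the strict epigraph, in the direction of some coordinate i, of a
   Lipschitz function of the other d - 1 coordinates. *)
Definition lipschitz_boundary (Omega : set 'rV[R]_d) : Prop :=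
  forall x0, (closure Omega `\` interior Omega) x0 ->
  exists (Q : 'M[R]_d) (i : 'I_d) (phi : 'rV[R]_d.-1 -> R) (L : R),
    [/\ Q *m Q^T = 1%:M,
        L.-lipschitz phi
      & \forall x \near x0,
          Omega x <-> phi (col' i (x *m Q)) < (x *m Q) 0 i].

Definition bounded_lipschitz_domain (Omega : set 'rV[R]_d) : Prop :=
  [/\ Omega !=set0, open Omega, connected Omega, bounded_set Omega
    & lipschitz_boundary Omega].

Definition partials (s : seq 'I_d) (phi : 'rV[R]_d -> R) : 'rV[R]_d -> R :=
  foldr (fun i f x => 'D_(delta_mx 0 i) f x) phi s.

Definition smooth (phi : 'rV[R]_d -> R) : Prop :=
  forall s : seq 'I_d, continuous (partials s phi) /\
    forall x i, derivable (partials s phi) x (delta_mx 0 i).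

Definition test_function (Omega : set 'rV[R]_d) (phi : 'rV[R]_d -> R) : Prop :=
  let supp := closure [set x | phi x != 0] in
  [/\ smooth phi, compact supp & supp `<=` Omega].

End domain.

Section function_spaces.
Variables (R : realType) (d : nat) (Omega : set 'rV[R]_d) (oOmega : open Omega).

Definition leb_on : {measure set 'rV[R]_d -> \bar R} :=
  mrestr (@lebesgue_rV R d) (open_measurable_rV oOmega).

(* Elements of [L2] are representatives defined on the whole space; [leb_on]
   ignores their values outside Omega, and equality in L^2(Omega) is equality
   [leb_on]-almost everywhere. *)
Definition L2 : Type := LfunType leb_on (lee1n 2).

Definition inner (f g : 'rV[R]_d -> R) : R := \int[leb_on]_x (f x * g x).

Definition L2norm (f : L2) : R := fine ('N[leb_on]_2%:E[EFin \o f])%E.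

(* Since Omega is bounded, L^oo(Omega) is contained in L^2(Omega), so the ball is
   a set of elements of [L2]. *)
Definition bounded_on_Linf_ball (F : L2 -> R) : Prop :=
  exists M : R, forall w : L2,
    ('N[leb_on]_+oo[EFin \o w] <= 1)%E -> `|F w| <= M.

Definition frechet_derivative (j : L2 -> R) (w : L2) (A : L2 -> R) : Prop :=
  [/\ scalar A,
      exists K : R, forall h, `|A h| <= K * L2norm h
    & forall e : R, 0 < e -> exists2 delta : R, 0 < delta &
        forall h, L2norm h <= delta -> `|j (w + h) - j w - A h| <= e * L2norm h].

Definition riesz_representative (A : L2 -> R) (g : L2) : Prop :=
  forall h : L2, A h = inner g h.

Definition weak_partial (i : 'I_d) (w g : L2) : Prop :=
  forall phi, test_function Omega phi ->
    inner w (fun x => 'D_(delta_mx 0 i) phi x) = - inner g phi.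

Definition weak_gradient (w : L2) (G : 'I_d -> L2) : Prop :=
  forall i, weak_partial i w (G i).

Definition H1 : set L2 := [set w | exists G, weak_gradient w G].

(* Weak gradients are unique up to [leb_on]-null sets, so for w in H1 the choice
   of a representative is immaterial; for w not in H1 the value is irrelevant. *)
Definition nabla (w : L2) : 'I_d -> L2 := xget (fun=> 0) (weak_gradient w).

Definition sqr_nabla (w : L2) (x : 'rV[R]_d) : R :=
  \sum_(i < d) (nabla w i x) ^+ 2.

Definition unit_valued (w : L2) : Prop := {ae leb_on, forall x, 0 <= w x <= 1}.

Definition binary_valued (w : L2) : Prop :=
  {ae leb_on, forall x, w x = 0 \/ w x = 1}.

Definition Psi (t : R) : \bar R :=
  if 0 <= t <= 1 then (t * (1 - t))%:E else +oo%E.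

Definition energy (eps : R) (w : L2) : \bar R :=
  if w \in H1 then
    (\int[leb_on]_x ((eps / 2 * sqr_nabla w x)%:E + eps^-1%:E * Psi (w x)))%E
  else +oo%E.

Definition dirichlet (w : L2) : \bar R :=
  if w \in H1 then (\int[leb_on]_x (sqr_nabla w x)%:E)%E else +oo%E.

End function_spaces.

Section homotopy_trust_region.
Variables (R : realType) (d : nat) (Omega : set 'rV[R]_d) (oOmega : open Omega).
Local Notation L2 := (L2 oOmega).
Variables (gamma : R) (j : L2 -> R) (gradj : L2 -> L2).

Definition feasible (wbar : L2) (Delta : R) : set L2 :=
  [set w | L2norm (w - wbar) ^+ 2 <= Delta /\ unit_valued w].

Definition TR_objective (eps : R) (wbar g w : L2) : \bar R :=
  ((inner oOmega g (w - wbar))%:E + gamma%:E * energy eps w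
     - gamma%:E * energy eps wbar)%E.

Definition TRc_objective (eps : R) (wbar g w : L2) : \bar R :=
  ((inner oOmega (fun x => g x + gamma / eps * (1 - 2 * wbar x)) (w - wbar))%:E
     + (gamma * (eps / 2))%:E * dirichlet w
     - (gamma * (eps / 2))%:E * dirichlet wbar)%E.

(* The boolean is the flag of the algorithm: true for the linearized potential. *)
Definition objective (fl : bool) : R -> L2 -> L2 -> L2 -> \bar R :=
  if fl then TRc_objective else TR_objective.

Definition minimizer (fl : bool) (eps : R) (wbar g : L2) (Delta : R) (w : L2)
    : Prop :=
  feasible wbar Delta w /\
  forall v, feasible wbar Delta v ->
    (objective fl eps wbar g w <= objective fl eps wbar g v)%E.

Definition act_red (w v : L2) (eps : R) : \bar R :=
  ((j w)%:E + gamma%:E * energy eps w - (j v)%:E - gamma%:E * energy eps v)%E.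

Definition pred_red (fl : bool) (w : L2) (Delta eps : R) : \bar R :=
  (- ereal_inf (objective fl eps w (gradj w) @` feasible w Delta))%E.

Record state := State {
  iterate : L2;
  radius : R;
  min_radius : R;
  epsilon : R;
  kappa : R;
  flag : bool }.

Variables (rho Delta0 r : R).

Definition accepted (s : state) (wt : L2) : bool :=
  ((rho%:E * pred_red (flag s) (iterate s) (radius s) (epsilon s)
      <= act_red (iterate s) wt (epsilon s)) &&
   ((kappa s * min_radius s)%:E < act_red (iterate s) wt (epsilon s)))%E.

(* The trust-region update reads the flag as modified by a possible acceptance,
   whereas [accepted] reads the flag used to compute the trial iterate. *)
Definition next_state (s : state) (wt : L2) : state :=
  let acc := accepted s wt in
  let w := if acc then wt else iterate s in
  let Delta := if acc then Num.min Delta0 (2 * radius s) else radius s / 2 in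
  let fl := acc || flag s in
  if Delta < min_radius s then
    if fl then State w Delta0 (min_radius s) (epsilon s) (kappa s) false
    else State w Delta0 (min_radius s / 2) (epsilon s / r) (kappa s / 2) true
  else State w Delta (min_radius s) (epsilon s) (kappa s) fl.

(* [s n] is the state at the beginning of iteration n. *)
Definition homotopy_TR_run (eps0 kappa0 minDelta0 : R) (w0 : L2)
    (s : nat -> state) : Prop :=
  s 0 = State w0 Delta0 minDelta0 eps0 kappa0 true /\
  forall n, exists2 wt : L2,
    minimizer (flag (s n)) (epsilon (s n)) (iterate (s n))
      (gradj (iterate (s n))) (radius (s n)) wt
    & s n.+1 = next_state (s n) wt.

End homotopy_trust_region.

(* Main.v *)
Require Import Defs.
From HB Require Import structures.
From mathcomp Require Import all_boot all_order all_algebra.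
From mathcomp Require Import all_classical all_reals all_analysis.
From mathcomp Require Import measurable_realfun.
From mathcomp Require Import ring lra.
Set Implicit Arguments. Unset Strict Implicit. Unset Printing Implicit Defensive.
Import Order.TTheory GRing.Theory Num.Theory.
Import numFieldNormedType.Exports.
Local Open Scope classical_set_scope.
Local Open Scope ring_scope.

(** The interface width epsilon decreases only when the trust region has shrunk
below its threshold in a phase with flag false, that is, while the exact
subproblem was being solved.  Such a phase starts with the radius Delta0,
whatever the iteration, and an acceptance would have ended it.  So before each
decrease the current iterate w was tested in the exact subproblem with radius
Delta0 and the trial step was rejected: the actual reduction was either tiny or
smaller than a fraction rho < 1 of the predicted one.  As j on unit valued
functions and the linear term on the trust region are bounded independently of
the iteration, w is then optimal up to a uniform constant C,
  energy eps w <= energy eps v + C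
for all unit valued v in H1 with L2norm (v - w) ^+ 2 <= Delta0
([rejected_energy_le]).

This weak optimality bounds the energy of w uniformly in eps ([energy_bound]).
Erase w in a thin slab a < x_0 < b, replacing it by (1 - theta) w, where theta
is the difference of two logistic steps of width eps centred at a and b.  The
new function is admissible because the slab is thin.  The logistic step s solves
eps * s' = s * (1 - s), so that its gradient is controlled by its own potential,
whose integral is of order eps; hence the two transition layers created at the
faces of the slab cost only a constant ([cutoff_density_le],
[cutoff_competitor]).  The optimality of w then bounds by a constant the energy
that w had in the slab, and boundedly many slabs cover Omega since Omega is
bounded ([sum_slab_energy_le]).

Hence the energy is below a fixed bound B at each iterate at which epsilon is
decreased.  If energies below B occur infinitely often, those iterates are the
subsequence.  Otherwise epsilon is constant from some index on, and since an
accepted step has a positive actual reduction, j + gamma * energy does not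
increase any more: the tail of the sequence is the subsequence.

The energy is defined from a chosen weak gradient, whereas the estimates need
the explicit gradient of (1 - theta) w.  Both agree almost everywhere by the
product rule [weak_partialM] and the fundamental lemma of the calculus of
variations [fundamental_lemma], which in turn needs a supply of smooth compactly
supported functions. *)

(** * Smooth functions *)

Section smooth_functions.
Variables (R : realType) (d : nat).
Implicit Types f g : 'rV[R]_d -> R.
Local Notation e i := (delta_mx 0 i : 'rV[R]_d).

(** A coinduction principle: a class of continuous partially derivable functions
that is stable under partial derivatives consists of smooth functions. *)
Lemma smooth_class (C : ('rV[R]_d -> R) -> Prop) :
  (forall f, C f -> [/\ continuous f, forall x i, derivable f x (e i)
                      & forall i, C (fun x => 'D_(e i) f x)]) ->
  forall f, C f -> smooth f.
Proof.
move=> Ccl f Cf s.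
suff Cs : C (partials s f) by have [? ? _] := Ccl _ Cs; split.
by elim: s => [//|i s IH] /=; have [_ _] := Ccl _ IH; exact.
Qed.

Lemma smooth_continuous f : smooth f -> continuous f.
Proof. by move=> /(_ [::]) []. Qed.

Lemma smooth_derivable f x i : smooth f -> derivable f x (e i).
Proof. by move=> /(_ [::]) []. Qed.

Lemma smooth_derive f i : smooth f -> smooth (fun x => 'D_(e i) f x).
Proof.
move=> sf s; have := sf (rcons s i).
by rewrite /partials -cats1 foldr_cat.
Qed.

(** Sums and products of smooth functions, as a class to which [smooth_class]
applies: the Leibniz rule turns a product into a sum of products, so that the
products alone would not be stable under derivation. *)
Inductive smooth_algebra : ('rV[R]_d -> R) -> Prop :=
| smooth_algebra_gen f : smooth f -> smooth_algebra f
| smooth_algebraD f g : smooth_algebra f -> smooth_algebra g ->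
    smooth_algebra (fun x => f x + g x)
| smooth_algebraM f g : smooth_algebra f -> smooth_algebra g ->
    smooth_algebra (fun x => f x * g x).

Lemma smooth_algebra_smooth f : smooth_algebra f -> smooth f.
Proof.
apply: smooth_class => {}f; elim => {f} [f sf|f g Af [cf df Df] Ag [cg dg Dg]
    |f g Af [cf df Df] Ag [cg dg Dg]].
- split=> [|x i|i]; first exact: smooth_continuous.
  + exact: smooth_derivable.
  + exact/smooth_algebra_gen/smooth_derive.
- split=> [x|x i|i].
  + by apply: continuousD; [exact: cf|exact: cg].
  + by apply: derivableD.
  + rewrite [X in smooth_algebra X](_ : _ =
      fun x => 'D_(e i) f x + 'D_(e i) g x); first exact: smooth_algebraD.
    by apply/funext => x; rewrite deriveD.
- split=> [x|x i|i].
  + by apply: continuousM; [exact: cf|exact: cg].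
  + by apply: derivableM; [exact: df|exact: dg].
  + rewrite [X in smooth_algebra X](_ : _ =
      fun x => f x * 'D_(e i) g x + g x * 'D_(e i) f x).
      by apply: smooth_algebraD; apply: smooth_algebraM.
    by apply/funext => x; rewrite deriveM.
Qed.

Lemma smoothD f g : smooth f -> smooth g -> smooth (fun x => f x + g x).
Proof.
by move=> sf sg; apply/smooth_algebra_smooth/smooth_algebraD; exact: smooth_algebra_gen.
Qed.

Lemma smoothM f g : smooth f -> smooth g -> smooth (fun x => f x * g x).
Proof.
by move=> sf sg; apply/smooth_algebra_smooth/smooth_algebraM; exact: smooth_algebra_gen.
Qed.

Lemma smooth_cst (c : R) : smooth (fun _ : 'rV[R]_d => c).
Proof.
apply: (@smooth_class (fun f => exists c, f = cst c)); last by exists c.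
move=> _ [k ->]; split => [|x i|i]; [exact: cst_continuous|exact: derivable_cst|].
by exists 0; apply/funext => x; rewrite derive_cst.
Qed.

(** The one-variable counterpart of [smooth]: an explicit function of one real
variable is shown to be smooth by iterating its ordinary derivative, and then
composed with a coordinate by [smooth_ridge]. *)
Definition smooth1 (g : R -> R) := forall n x, derivable g^`(n)%classic x 1.

Lemma is_derive_ridge (g : R -> R) (i k : 'I_d) (a b : R) (x : 'rV[R]_d) :
  derivable g (a * x 0 i + b) 1 ->
  is_derive x (e k) (fun y : 'rV[R]_d => g (a * y 0 i + b))
    (a * (i == k)%:R * g^`()%classic (a * x 0 i + b)).
Proof.
move=> dg.
(* The partial derivative is the ordinary derivative at 0 of
   h |-> g (c * h + (a * x 0 i + b)). *)
pose c := a * (i == k)%:R : R.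
pose G (h : R) := g (c * h + (a * x 0 i + b)).
have GE : (fun h : R => g (a * (h *: e k + x) 0 i + b)) = G.
  by apply/funext => h; rewrite /G !mxE /= eq_sym /c; congr g; rewrite eq_sym; ring.
have dG : is_derive (0 : R) (1 : R) G (c * g^`()%classic (a * x 0 i + b)).
  rewrite /G [X in is_derive _ _ _ X]mulrC.
  pose l (h : R) := c * h + (a * x 0 i + b).
  have dl : is_derive (0 : R) (1 : R) l c.
    rewrite (_ : l = (c *: (id : R -> R)) + cst (a * x 0 i + b)); last exact/funext.
    by apply: is_derive_eq; rewrite addr0 [_ *: _]mulr1.
  have dgl : is_derive (l 0) (1 : R) g (g^`()%classic (l 0)).
    rewrite derive1E; apply: derivableP; rewrite /l mulr0 add0r; exact: dg.
  have := @is_derive1_comp R g l 0 _ _ dgl dl.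
  by rewrite {2}/l mulr0 add0r.
split; first by apply/derivable1P; rewrite GE.
rewrite -[RHS](@derive_val _ _ _ _ _ _ _ dG) -GE /derive.
set g1 := fun h => h^-1 *: _; set g2 := fun h => h^-1 *: _.
suff -> : g1 = g2 by [].
by apply/funext => h; rewrite /g1 /g2 /= addr0 scale0r add0r [_%:A]mulr1.
Qed.

(** The class used is that of the multiples of the ridge functions built on the
iterated derivatives of g, which [is_derive_ridge] shows to be stable. *)
Lemma smooth_ridge (g : R -> R) (i : 'I_d) (a b : R) : smooth1 g ->
  smooth (fun x : 'rV[R]_d => g (a * x 0 i + b)).
Proof.
move=> sg.
pose C f := exists c n, f = fun x : 'rV[R]_d => c * g^`(n)%classic (a * x 0 i + b).
apply: (@smooth_class C); last first.
  by exists 1, 0%N; apply/funext => x; rewrite mul1r.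
move=> _ [c [n ->]].
have D x k := @is_derive_ridge _ i k a b x (sg n (a * x 0 i + b)).
split => [x|x k|k].
- pose l (y : 'rV[R]_d) := a * y 0 i + b.
  have cl : {for x, continuous l}.
    apply: continuousD; last exact: cst_continuous.
    by apply: continuousM; [exact: cst_continuous|exact: coord_continuous].
  have cgl : {for x, continuous (g^`(n)%classic \o l)}.
    apply: continuous_comp cl _.
    by apply: differentiable_continuous; apply/derivable1_diffP; exact: sg.
  exact: (continuousM (@cst_continuous _ _ c x) cgl).
- by apply: derivableM => //; have [] := D x k.
- exists (c * (a * (i == k)%:R)), n.+1; apply/funext => x.
  rewrite deriveMl; last by have [] := D x k.
  by rewrite (@derive_val _ _ _ _ _ _ _ (D x k)) derive1nS -[RHS]mulrA.
Qed.

End smooth_functions.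

Section smooth1_functions.
Variable R : realType.

Lemma smooth1_class (C : (R -> R) -> Prop) :
  (forall f, C f -> (forall x, derivable f x 1) /\ C f^`()%classic) ->
  forall f, C f -> smooth1 f.
Proof.
move=> Ccl f Cf n.
suff Cs : C f^`(n)%classic by have [] := Ccl _ Cs.
by elim: n => [//|n IH]; rewrite derive1nS; have [_] := Ccl _ IH.
Qed.

(** ** The logistic function *)

Definition sigmoid (y : R) : R := (1 + expR (- y))^-1.

Lemma sigmoid_gt0 (y : R) : 0 < sigmoid y.
Proof. by rewrite invr_gt0 addr_gt0// expR_gt0. Qed.

Lemma sigmoid_lt1 (y : R) : sigmoid y < 1.
Proof. by rewrite invf_lt1 ?ltrDl ?expR_gt0// addr_gt0// expR_gt0. Qed.

Lemma sigmoid_le (x y : R) : x <= y -> sigmoid x <= sigmoid y.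
Proof.
move=> xy; rewrite lef_pV2 ?posrE ?addr_gt0 ?expR_gt0//.
by rewrite lerD2l ler_expR lerN2.
Qed.

Lemma sigmoid0 : sigmoid 0 = 2^-1.
Proof. by rewrite /sigmoid oppr0 expR0. Qed.

Lemma sigmoid_gt_half (y : R) : 0 < y -> 2^-1 < sigmoid y.
Proof.
move=> y0; rewrite -sigmoid0 ltf_pV2 ?posrE ?addr_gt0 ?expR_gt0//.
by rewrite ltrD2l ltr_expR ltrN2.
Qed.

Global Instance is_derive_sigmoid (y : R) :
  is_derive y (1 : R) sigmoid (sigmoid y * (1 - sigmoid y)).
Proof.
have p0 : 1 + expR (- y) != 0 by rewrite gt_eqF// addr_gt0// expR_gt0.
have dp : is_derive y (1 : R) (fun t => 1 + expR (- t)) (- expR (- y)).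
  have h := is_derive1_comp (is_derive_expR (- y)) (is_deriveNid y (1 : R)).
  rewrite mulrN1 in h.
  have := is_deriveD (is_derive_cst (1 : R) y 1) h.
  by rewrite add0r.
have [d1 d2] := dp.
split; first exact: derivableV.
rewrite deriveV// d2 /sigmoid [_ *: _]mulrN mulrC.
by field.
Qed.

(** The logistic equation s' = s * (1 - s) makes the polynomials in s a class
stable under derivation. *)
Lemma smooth1_sigmoid : smooth1 sigmoid.
Proof.
pose C f := exists p : {poly R}, f = fun y => p.[sigmoid y].
apply: (@smooth1_class C); last by exists 'X; apply/funext => y; rewrite hornerX.
move=> _ [p ->].
have D (y : R) : is_derive y (1 : R) (fun y => p.[sigmoid y])
    ((p^`() * ('X * (1 - 'X))).[sigmoid y]).
  have := is_derive1_comp (is_derive_poly p (sigmoid y)) (is_derive_sigmoid y).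
  by rewrite !hornerE.
split=> [y|]; first by have [] := D y.
exists (p^`() * ('X * (1 - 'X)))%R; apply/funext => y.
by rewrite derive1E (@derive_val _ _ _ _ _ _ _ (D y)).
Qed.

(** ** The flat function exp (- c / t) *)

(** Each monomial of p is compared with the corresponding term of the series of
expR (c * s). *)
Lemma poly_expR_bounded (c : R) (p : {poly R}) : 0 < c ->
  exists K, forall s, 0 < s -> `|p.[s]| * expR (- (c * s)) <= K.
Proof.
move=> c0.
exists (\sum_(i < size p) `|p`_i| * (i`!%:R / c ^+ i)) => s s0.
rewrite horner_coef.
apply: (@le_trans _ _ ((\sum_(i < size p) `|p`_i| * s ^+ i) * expR (- (c * s)))).
  rewrite ler_wpM2r ?expR_ge0//; apply: (le_trans (ler_norm_sum _ _ _)).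
  by apply: ler_sum => i _; rewrite normrM [X in _ * X]ger0_norm// exprn_ge0// ltW.
rewrite mulr_suml; apply: ler_sum => i _.
rewrite -mulrA ler_wpM2l// expRN ler_pdivrMr ?expR_gt0//.
have cs0 : 0 <= c * s by rewrite mulr_ge0// ltW.
have f0 : 0 < (i`!%:R : R) by rewrite ltr0n fact_gt0.
have : (c * s) ^+ i / i`!%:R <= expR (c * s).
  case: (nat_of_ord i) => [|k]; first by rewrite expr0 fact0 divr1 -expR0 ler_expR.
  by apply: le_trans (expR_ge1Dxn k cs0); rewrite lerDr.
rewrite ler_pdivrMr// exprMn -ler_pdivlMl ?exprn_gt0// => h.
by apply: (le_trans h); rewrite mulrC -mulrA mulrC.
Qed.

(** The functions p(1/t) exp(-c/t), extended by 0 to t <= 0.  The polynomial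
factor makes them a class stable under derivation. *)
Definition flat_exp (c : R) (p : {poly R}) (t : R) : R :=
  if 0 < t then p.[t^-1] * expR (- (c * t^-1)) else 0.

Let flat_exp_deriv (c : R) (p : {poly R}) := (c%:P * p - p^`())%R * 'X^2.

(** The point that matters is t = 0: there the difference quotient is
p(1/t) exp(-c/t) / t for t > 0, which is bounded by K * t according to
[poly_expR_bounded] applied to p * 'X^2. *)
Lemma is_derive_flat_exp (c : R) (p : {poly R}) (t : R) : 0 < c ->
  is_derive t (1 : R) (flat_exp c p) (flat_exp c (flat_exp_deriv c p) t).
Proof.
move=> c0; have [t0|t0|->] := ltgtP t 0.
- rewrite [X in is_derive _ _ _ X]/flat_exp ltNge (ltW t0)/=.
  apply: (near_eq_is_derive _ (is_derive_cst (0 : R) t (1 : R))).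
  near=> x; rewrite /flat_exp ltNge ifF//; apply/negbTE; rewrite negbK.
  by rewrite ltW//; near: x; exact: lt_nbhsl.
- have inv : is_derive t (1 : R) (fun x : R => x^-1) (- t^-2).
    split; first by apply: derivableV; rewrite ?gt_eqF.
    by rewrite deriveV ?gt_eqF// derive_id [_ *: _]mulr1.
  have d1 := is_derive1_comp (is_derive_poly p t^-1) inv.
  have d2' : is_derive t (1 : R) (fun x : R => - (c * x^-1)) (c * t^-2).
    have := is_deriveN (is_deriveZ c inv).
    by rewrite [_ *: _]mulrN opprK.
  have d2 := @is_derive1_comp R expR (fun x => - (c * x^-1)) t _ _
    (is_derive_expR (- (c * t^-1))) d2'.
  have d12 := is_deriveM d1 d2.
  move: d12.
  rewrite [X in is_derive _ _ _ X](_ : _ = flat_exp c (flat_exp_deriv c p) t); last first.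
    rewrite /flat_exp t0 /flat_exp_deriv !hornerE /= /GRing.scale /=.
    by rewrite -exprVn; ring.
  apply: near_eq_is_derive.
  near=> x; rewrite /flat_exp ifT//.
  by near: x; exact: lt_nbhsr.
- rewrite [X in is_derive _ _ _ X]/flat_exp ltxx.
  have [K KP] := poly_expR_bounded (p * 'X^2) c0.
  have K0 : 0 <= K by apply: le_trans (KP 1 ltr01); rewrite mulr_ge0// expR_ge0.
  have le u : `|u^-1 * flat_exp c p u| <= K * `|u|.
    rewrite /flat_exp; case: ifPn => u1; last by rewrite mulr0 normr0 mulr_ge0.
    have iu : 0 < u^-1 by rewrite invr_gt0.
    have := KP _ iu.
    rewrite hornerM hornerXn expr2 !normrM (gtr0_norm iu) => h.
    rewrite (ger0_norm (expR_ge0 _)) (gtr0_norm u1).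
    apply: le_trans (ler_wpM2r (ltW u1) h); rewrite le_eqVlt; apply/orP; left.
    by apply/eqP; field; rewrite gt_eqF.
  have L : (fun h : R => h^-1 *: ((flat_exp c p \o shift 0) (h *: 1) - flat_exp c p 0))
      @ 0^' --> (0 : R).
    have K1 : 0 < K + 1 by rewrite ltr_wpDl.
    apply/cvgr0Pnorm_le => e e0; near=> h.
    rewrite /= addr0 [h%:A]mulr1 {2}/flat_exp ltxx subr0.
    apply: le_trans (le h) _.
    apply: (@le_trans _ _ ((K + 1) * `|h|)); first by rewrite ler_wpM2r// lerDl.
    rewrite mulrC -ler_pdivlMr//.
    near: h; apply: dnbhs0_le; exact: divr_gt0.
  by split; [apply/cvg_ex; exists 0|exact: cvg_lim L].
Unshelve. all: by end_near. Qed.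

Lemma smooth1_flat_exp c p : 0 < c -> smooth1 (flat_exp c p).
Proof.
move=> c0; pose C f := exists p, f = flat_exp c p.
apply: (@smooth1_class C); last by exists p.
move=> _ [q ->]; split=> [t|]; first by have [] := is_derive_flat_exp q t c0.
exists (flat_exp_deriv c q); apply/funext => t.
by rewrite derive1E (@derive_val _ _ _ _ _ _ _ (is_derive_flat_exp q t c0)).
Qed.

End smooth1_functions.

(** * Boxes *)

Section boxes.
Variables (R : realType) (d : nat).
Implicit Types a b : 'rV[R]_d.

Definition box a b : set 'rV[R]_d := [set x | forall i, a 0 i < x 0 i < b 0 i].
Definition cbox a b : set 'rV[R]_d := [set x | forall i, a 0 i <= x 0 i <= b 0 i].

Lemma box_cbox a b : box a b `<=` cbox a b.
Proof. by move=> x xab i; have /andP[/ltW-> /ltW->] := xab i. Qed.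

Lemma norm_coord_le (x : 'rV[R]_d) (i : 'I_d) : `|x 0 i| <= `|x|.
Proof.
have /mapP[k _ ->] : `|x 0 i| \in [seq `|x y.1 y.2| | y : 'I_1 * 'I_d].
  by apply/mapP; exists (ord0, i); rewrite //= mem_enum.
by rewrite [leRHS]/Num.norm /= mx_normrE; apply/bigmax_geP; right => /=; exists k.
Qed.

Lemma measurable_box a b : measurable (box a b).
Proof.
rewrite (_ : box a b =
    \bigcap_i [set x : 'rV[R]_d | x 0 i \in `]a 0 i, b 0 i[]); last first.
  apply/seteqP; split => x /= Bx i; first by move=> _; rewrite /= in_itv/= Bx.
  by have := Bx i Logic.I; rewrite /= in_itv.
apply: fin_bigcap_measurable => [|i _]; first exact: finite_finset.
rewrite -[X in measurable X]setTI.
have -> : [set x : 'rV[R]_d | x 0 i \in `]a 0 i, b 0 i[] =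
  (fun x : 'rV[R]_d => x 0 i) @^-1` `]a 0 i, b 0 i[%classic by [].
by apply: measurable_coord => //; exact: measurable_itv.
Qed.

Lemma boxI a b a' b' : box a b `&` box a' b' =
  box (\row_i Num.max (a 0 i) (a' 0 i)) (\row_i Num.min (b 0 i) (b' 0 i)).
Proof.
apply/seteqP; split => x /=.
  by move=> [h h'] i; rewrite !mxE gt_max lt_min; have /andP[-> ->] := h i; have := h' i.
move=> h; split => i; have := h i; rewrite !mxE gt_max lt_min.
  by case/andP => /andP[-> _] /andP[->].
by case/andP => /andP[_ ->] /andP[_ ->].
Qed.

Lemma compact_cbox a b : compact (cbox a b).
Proof.
have -> : cbox a b = [set x : 'rV[R]_d | forall i, `[a 0 i, b 0 i]%classic (x 0 i)].
  by apply/seteqP; split => x /= h i; have := h i; rewrite in_itv.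
by apply: (@rV_compact _ _ (fun i => `[a 0 i, b 0 i]%classic)) => i; exact: segment_compact.
Qed.

Lemma measurable_cbox a b : measurable (cbox a b).
Proof.
rewrite -(setCK (cbox a b)); apply: measurableC; apply: open_measurable_rV.
apply: closed_openC.
by apply: compact_closed; [exact: norm_hausdorff|exact: compact_cbox].
Qed.

Definition box_system : set (set 'rV[R]_d) := [set B | exists a b, B = box a b].

(** The half-spaces x_i > r, which generate the sigma-algebra, are increasing
unions of bounded boxes. *)
Lemma sigma_box_measurable :
  @measurable _ ('rV[R]_d) = <<s box_system >>.
Proof.
apply/seteqP; split; last first.
  apply: smallest_sub; first exact: sigma_algebra_measurable.
  by move=> _ [a [b ->]]; exact: measurable_box.
move=> A mA.
have mid : measurable_fun setT (id : g_sigma_algebraType box_system -> 'rV[R]_d).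
  apply: measurable_fun_rV => i.
  apply: (measurability _ (RGenOInfty.measurableE R)) => _ [_ [r ->] <-].
  rewrite setTI.
  have -> : (fun t : 'rV[R]_d => t 0 i) @^-1` `]r, +oo[ =
      \bigcup_n box (\row_k if k == i then r else - n%:R) (const_mx n%:R).
    apply/seteqP; split => x /=.
      rewrite in_itv/= andbT => rx.
      have [n nx] : exists n : nat, `|x| < n%:R.
        by exists (Num.bound `|x|); exact: archi_boundP.
      have xn k : `|x 0 k| < n%:R.
        by exact: le_lt_trans (norm_coord_le _ _) nx.
      exists n => // k; rewrite !mxE.
      have := xn k; rewrite ltr_norml => /andP[x1 ->]; rewrite andbT.
      by case: eqP => [->|].
    move=> [n _ /(_ i)]; rewrite !mxE eqxx in_itv/= andbT.
    by case/andP.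
  apply: bigcupT_measurable => n.
  by apply: sub_sigma_algebra; eexists; eexists; reflexivity.
by have := mid measurableT A mA; rewrite setTI.
Qed.

End boxes.

(** * Smooth bump functions on boxes *)

Section bump.
Variables (R : realType) (d : nat).
Implicit Types a b : 'rV[R]_d.

Lemma smooth_prod (I : Type) (r : seq I) (F : I -> 'rV[R]_d -> R) :
  (forall i, smooth (F i)) -> smooth (fun x => \prod_(i <- r) F i x).
Proof.
move=> sF; elim: r => [|i r IH].
  by under eq_fun do rewrite big_nil; exact: smooth_cst.
by under eq_fun do rewrite big_cons; exact: smoothM.
Qed.

(** The parameter c makes the bump steep: as c tends to 0 it converges to the
indicator of the box ([cvg_box_bump]), while its support is fixed. *)
Definition box_bump (c : R) a b (x : 'rV[R]_d) : R :=
  \prod_i (flat_exp c 1 (x 0 i - a 0 i) * flat_exp c 1 (b 0 i - x 0 i)).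

Lemma flat_exp_ge0 (c t : R) : 0 <= flat_exp c 1 t.
Proof. by rewrite /flat_exp; case: ifP => // _; rewrite hornerE mul1r expR_ge0. Qed.

Lemma flat_exp_le1 (c t : R) : 0 < c -> flat_exp c 1 t <= 1.
Proof.
move=> c0; rewrite /flat_exp; case: ifPn => // t0; rewrite hornerE mul1r.
by rewrite expR_le1 oppr_le0 mulr_ge0 ?invr_ge0// ltW.
Qed.

Lemma smooth_box_bump c a b : 0 < c -> smooth (box_bump c a b).
Proof.
move=> c0; apply: smooth_prod => i; apply: smoothM.
  have := smooth_ridge i 1 (- a 0 i) (@smooth1_flat_exp _ c 1 c0).
  by under eq_fun do rewrite mul1r.
have := smooth_ridge i (-1) (b 0 i) (@smooth1_flat_exp _ c 1 c0).
by under eq_fun do rewrite mulN1r addrC.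
Qed.

Lemma box_bump_ge0 c a b x : 0 <= box_bump c a b x.
Proof. by apply: prodr_ge0 => i _; rewrite mulr_ge0// flat_exp_ge0. Qed.

Lemma box_bump_le1 c a b x : 0 < c -> box_bump c a b x <= 1.
Proof.
move=> c0; apply: prodr_ile1 => i _; rewrite mulr_ge0 ?flat_exp_ge0//=.
by rewrite mulr_ile1 ?flat_exp_ge0 ?flat_exp_le1.
Qed.

Lemma box_bump_out c a b x : ~ box a b x -> box_bump c a b x = 0.
Proof.
move=> /existsNP[i /negP]; rewrite negb_and -!leNgt => xi.
rewrite /box_bump (bigD1 i)//=.
suff -> : flat_exp c 1 (x 0 i - a 0 i) * flat_exp c 1 (b 0 i - x 0 i) = 0.
  by rewrite mul0r.
apply/eqP; rewrite mulf_eq0 /flat_exp !subr_gt0.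
by case/orP: xi => h; rewrite (ltNge _ (x 0 i)) (ltNge (x 0 i)) h eqxx ?orbT.
Qed.

Lemma cvg_box_bump a b x : box a b x -> box_bump n.+1%:R^-1 a b x @[n --> \oo] --> (1 : R).
Proof.
move=> xab.
have cv (t : R) : 0 < t -> flat_exp n.+1%:R^-1 1 t @[n --> \oo] --> (1 : R).
  move=> t0; rewrite /flat_exp t0.
  under eq_fun do rewrite hornerE mul1r.
  suff : expR (- (n.+1%:R^-1 * t^-1)) @[n --> \oo] --> expR (- (0 * t^-1)).
    by rewrite mul0r oppr0 expR0.
  apply: continuous_cvg; first exact: continuous_expR.
  by apply: cvgN; apply: cvgM; [exact: cvg_harmonic|exact: cvg_cst].
have cv2 (u v : nat -> R) : (u n @[n --> \oo] --> (1 : R)) ->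
    (v n @[n --> \oo] --> (1 : R)) -> (u n * v n @[n --> \oo] --> (1 : R)).
  by move=> u1 v1; have h := cvgM u1 v1; rewrite mulr1 in h; exact: h.
rewrite /box_bump; elim: (index_enum _) => [|i r IH].
  by under eq_fun do rewrite big_nil; exact: cvg_cst.
under eq_fun do rewrite big_cons; apply: (cv2) => //.
have /andP[ai bi] := xab i.
by apply: (cv2); apply: (cv); rewrite subr_gt0.
Qed.

Lemma test_function_box_bump (Omega : set 'rV[R]_d) c a b : 0 < c ->
  cbox a b `<=` Omega -> test_function Omega (box_bump c a b).
Proof.
move=> c0 abO.
have sub : closure [set x | box_bump c a b x != 0] `<=` cbox a b.
  have : closed (cbox a b).
    by apply: compact_closed; [exact: norm_hausdorff|exact: compact_cbox].
  move=> /closure_id ->; apply: closureS => x /= /eqP bx.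
  by apply: box_cbox; apply: contrapT => /(box_bump_out c).
split; [exact: smooth_box_bump| |exact: subset_trans abO].
by apply: (@subclosed_compact _ _ (cbox a b)) => //; [exact: closed_closure|
  exact: compact_cbox].
Qed.

End bump.

(** * Square integrable functions *)

Section L2_space.
Variables (R : realType) (d : nat) (Omega : set 'rV[R]_d) (oOmega : open Omega).
Local Notation mu := (leb_on oOmega).
Local Notation L2 := (L2 oOmega).

Lemma leb_on_ae : {ae mu, forall x, Omega x}.
Proof.
exists (~` Omega); split; [|by rewrite /= /mrestr setICl measure0|by []].
by apply: measurableC; exact: open_measurable_rV.
Qed.

Lemma leb_on_fin : bounded_set Omega -> (mu setT < +oo)%E.
Proof.
move=> [M [_ OM]].
pose b : 'rV[R]_d := const_mx `|M + 1|.
apply: (@le_lt_trans _ _ (lebesgue_rV R d (cbox (- b) b))).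
  rewrite /= /mrestr setTI; apply: le_measure.
  - by rewrite inE; exact: open_measurable_rV.
  - by rewrite inE; exact: measurable_cbox.
  - move=> x Ox i; rewrite !mxE -ler_norml.
    apply: le_trans (norm_coord_le _ _) _.
    by apply: le_trans (OM (M + 1) _ _ Ox) (ler_norm _); rewrite ltrDl.
rewrite [X in (X < _)%E]lebesgue_rV_box ?ltry// => i.
by rewrite !mxE -subr_ge0 opprK addr_ge0.
Qed.

Lemma L2_sqr_integrable (f : L2) : mu.-integrable setT (fun x => (f x ^+ 2)%:E).
Proof. exact/Lfun2_integrable_sqr/LfunP. Qed.

Lemma L2_mul_integrable (f g : L2) : mu.-integrable setT (fun x => (f x * g x)%:E).
Proof.
have /Lfun1_integrable := Lfun2_mul_Lfun1 (LfunP f) (LfunP g).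
exact.
Qed.

Lemma L2_integrable (f : L2) : (mu setT < +oo)%E ->
  mu.-integrable setT (fun x => (f x)%:E).
Proof.
move=> mufin; apply/Lfun1_integrable/Lfun_subset12; last exact: LfunP.
by rewrite ge0_fin_numE.
Qed.

(** The norm is the real number underlying an extended one; the finiteness of the
L2 norm makes the equality with the integral true. *)
Lemma L2norm_sqr (f : L2) : ((L2norm f ^+ 2)%:E = \int[mu]_x (f x ^+ 2)%:E)%E.
Proof.
have : ('N[mu]_2%:E[EFin \o f] `^ 2 = \int[mu]_x (f x ^+ 2)%:E)%E.
  rewrite powR_Lnorm ?pnatr_eq0//; apply: eq_integral => x _ /=.
  by rewrite powR_mulrn// real_normK// num_real.
move=> <-; rewrite /L2norm.
have : ('N[mu]_2%:E[EFin \o f] \is a fin_num)%E.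
  by rewrite ge0_fin_numE ?Lnorm_ge0//; exact: Lfunction_finite.
case: ('N[mu]_2%:E[EFin \o f])%E (Lnorm_ge0 mu 2%:E (EFin \o f)) => //= r r0 _.
by rewrite powR_mulrn.
Qed.

Lemma L2_of_fun (f : 'rV[R]_d -> R) : measurable_fun setT f ->
  mu.-integrable setT (fun x => (f x ^+ 2)%:E) -> exists w : L2, w = f :> (_ -> _).
Proof.
move=> mf /integrableP[_ fi].
have Pf : f \in Lfun mu 2%:E.
  apply/andP; split; rewrite inE//= /finite_norm unlock poweR_lty//.
  apply: le_lt_trans fi; rewrite le_eqVlt; apply/orP; left; apply/eqP.
  apply: eq_integral => x _ /=.
  by rewrite powR_mulrn// normrX.
by exists (Lfun_Sub (lee1n 2) Pf).
Qed.

Lemma continuous_measurable_rV (f : 'rV[R]_d -> R) : continuous f ->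
  measurable_fun setT f.
Proof.
move=> cf; apply: (measurability _ (RGenOInfty.measurableE R)) => _ [_ [r ->] <-].
rewrite setTI; apply: open_measurable_rV.
by apply: open_comp => [x _|]; [exact: cf|exact: interval_open].
Qed.

Lemma L2_mul_bounded (f : 'rV[R]_d -> R) (M : R) (w : L2) :
  measurable_fun setT f -> (forall x, `|f x| <= M) ->
  exists u : L2, forall x, u x = f x * w x.
Proof.
move=> mf fM.
have mfw : measurable_fun setT (fun x => f x * w x) by exact: measurable_funM.
have [|u uE] := L2_of_fun mfw; last by exists u => x; rewrite uE.
have := integrableZl measurableT (M ^+ 2) (L2_sqr_integrable w).
apply: le_integrable => //.
  by apply/measurable_EFinP; exact: measurable_funX.
move=> x _; rewrite -EFinM !abse_EFin lee_fin -exprMn !normrX !normrM.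
have M0 : 0 <= M by exact: le_trans (fM x).
by rewrite (ger0_norm M0) lerXn2r ?nnegrE ?mulr_ge0// ler_wpM2r.
Qed.

(** Dominated convergence, along the bumps that converge to the indicator of the
box. *)
Lemma box_integral_eq0 (g : L2) (a b : 'rV[R]_d) : (mu setT < +oo)%E ->
  cbox a b `<=` Omega ->
  (forall phi, test_function Omega phi -> inner oOmega g phi = 0) ->
  (\int[mu]_(x in box a b) (g x)%:E = 0)%E.
Proof.
move=> mufin abO g0.
pose c n : R := n.+1%:R^-1.
have c0 n : 0 < c n by rewrite invr_gt0.
have mg : measurable_fun setT g by [].
have mb n : measurable_fun setT (box_bump (c n) a b).
  apply: continuous_measurable_rV; apply: smooth_continuous; exact: smooth_box_bump.
have gi := L2_integrable g mufin.
have gbi n : mu.-integrable setT (fun x => (g x * box_bump (c n) a b x)%:E).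
  apply: le_integrable gi => //.
    by apply/measurable_EFinP; exact: measurable_funM.
  move=> x _; rewrite lee_fin /= normrM ler_piMr//.
  by rewrite ger0_norm ?box_bump_ge0 ?box_bump_le1.

have z n : (\int[mu]_x (g x * box_bump (c n) a b x)%:E = 0)%E.
  have := g0 _ (test_function_box_bump (c0 n) abO).
  rewrite /inner /Rintegral => h.
  by rewrite -[LHS]fineK ?h//; exact: integrable_fin_num.
have [_ _] : [/\ mu.-integrable setT (fun x => (g x * \1_(box a b) x)%:E),
    [sequence \int[mu]_x `|(g x * box_bump (c n) a b x)%:E - (g x * \1_(box a b) x)%:E|]_n
      @ \oo --> 0 &
    [sequence \int[mu]_x (g x * box_bump (c n) a b x)%:E]_n @ \oo -->
      \int[mu]_x (g x * \1_(box a b) x)%:E]%E.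
  apply: (@dominated_convergence _ _ _ mu setT measurableT
    (fun n x => (g x * box_bump (c n) a b x)%:E) (fun x => (g x * \1_(box a b) x)%:E)
    (fun x => `|g x|%:E)).
  - by move=> n; apply/measurable_EFinP; exact: measurable_funM.
  - apply/measurable_EFinP; apply: measurable_funM => //.
    by apply: measurable_indic; exact: measurable_box.
  - apply: aeW => x _; apply: cvg_EFin; first exact: nearW.
    apply: cvgMl_tmp; rewrite indicE; case: (boolP (x \in box a b)).
      by rewrite inE => /cvg_box_bump.
    rewrite notin_setE => nx; under eq_fun do rewrite box_bump_out//.
    exact: cvg_cst.
  - exact: integrable_norm gi.
  - apply: aeW => x n _; rewrite lee_fin normrM ler_piMr//.
    by rewrite ger0_norm ?box_bump_ge0 ?box_bump_le1.
rewrite (_ : [sequence _]_n = cst 0%E); last by apply/funext => n; exact: z.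
move=> /(cvg_lim (@ereal_hausdorff R)); rewrite lim_cst// => h.
rewrite integral_mkcond [RHS]h.
apply: eq_integral => x _; rewrite patchE indicE; case: ifP => _.
  by rewrite mulr1.
by rewrite mulr0.
Qed.

End L2_space.

(** * The fundamental lemma of the calculus of variations *)

Section fundamental_lemma.
Variables (R : realType) (d : nat) (Omega : set 'rV[R]_d) (oOmega : open Omega).
Local Notation mu := (leb_on oOmega).
Local Notation L2 := (L2 oOmega).

(** A Dynkin class argument: the boxes are stable under intersection and generate
the sigma-algebra, and the intersection of two boxes is a box contained in the
first one, to which [box_integral_eq0] applies. *)
Lemma measurable_integral_eq0 (g : L2) (a b : 'rV[R]_d) (A : set 'rV[R]_d) :
  (mu setT < +oo)%E -> cbox a b `<=` Omega ->
  (forall phi, test_function Omega phi -> inner oOmega g phi = 0) ->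
  measurable A -> (\int[mu]_(x in box a b `&` A) (g x)%:E = 0)%E.
Proof.
move=> mufin abO g0.
have mK := measurable_box a b.
have gi := L2_integrable g mufin.
have giS B : measurable B -> mu.-integrable B (fun x => (g x)%:E).
  by move=> mB; exact: integrableS gi.
rewrite sigma_box_measurable => sA.
pose P : set_system 'rV[R]_d :=
  [set B | (\int[mu]_(x in box a b `&` B) (g x)%:E = 0)%E].
suff : P A by [].
apply: (dynkin_induction (@sigma_box_measurable R d) _ _ _ _ _ sA).
- move=> _ _ [a1 [b1 ->]] [a2 [b2 ->]]; rewrite boxI.
  by eexists; eexists; reflexivity.
- by rewrite /P /= setIT; exact: box_integral_eq0.
- move=> _ [a1 [b1 ->]]; rewrite /P /= boxI; apply: box_integral_eq0 => //.
  move=> x xc; apply: abO => i; have := xc i.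
  by rewrite !mxE ge_max le_min => /andP[/andP[-> _] /andP[->]].
- move=> S mS; rewrite /P /= => S0.
  have := box_integral_eq0 mufin abO g0.
  rewrite -{1}(setIT (box a b)) -(setUv S) setIUr integral_setU.
  + by rewrite S0 add0e.
  + exact: measurableI.
  + by apply: measurableI => //; exact: measurableC.
  + apply: (measurable_int mu); apply: giS.
    by apply: measurableU; apply: measurableI => //; exact: measurableC.
  + by apply/disj_setPS => x [[_ ?] [_]].
- move=> F mF tF F0; rewrite /P /= setI_bigcupr integral_bigcup.
  + by rewrite eseries0// => n _ _; exact: F0.
  + exact: trivIset_setIl.
  + by move=> k; exact: measurableI.
  + by apply: giS; apply: bigcupT_measurable => k; exact: measurableI.
Qed.

(** By [measurable_integral_eq0] g vanishes almost everywhere on each box whose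
closure is in Omega, and Omega is the union of countably many such boxes: those
with rational centre and side 2 / (k + 1). *)
Lemma fundamental_lemma (g : L2) : (mu setT < +oo)%E ->
  (forall phi, test_function Omega phi -> inner oOmega g phi = 0) ->
  {ae mu, forall x, g x = 0}.
Proof.
move=> mufin g0.
have gi := L2_integrable g mufin.
have K a b : cbox a b `<=` Omega -> {ae mu, forall x, box a b x -> g x = 0}.
  move=> abO.
  have : ae_eq mu (box a b) (fun x => (g x)%:E) (cst 0%E).
    apply: integral_ae_eq.
    - exact: measurable_box.
    - by apply: integrableS gi => //; exact: measurable_box.
    - exact: measurable_cst.
    - move=> E EK mE; rewrite integral0 -(setIidr EK).
      exact: measurable_integral_eq0.
  by apply: filterS => x /= h /h [].
pose a (qk : {ffun 'I_d -> rat} * nat) : 'rV[R]_d :=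
  \row_i (ratr (qk.1 i) - qk.2.+1%:R^-1).
pose b (qk : {ffun 'I_d -> rat} * nat) : 'rV[R]_d :=
  \row_i (ratr (qk.1 i) + qk.2.+1%:R^-1).
have ae_all : {ae mu, forall x, forall n qk, unpickle n = Some qk ->
    cbox (a qk) (b qk) `<=` Omega -> box (a qk) (b qk) x -> g x = 0}.
  apply/ae_foralln => n.
  case E : (@unpickle ({ffun 'I_d -> rat} * nat)%type n) => [qk|]; last first.
    by apply: aeW => x qk.
  have [sub|nsub] := pselect (cbox (a qk) (b qk) `<=` Omega).
    by apply: filterS (K _ _ sub) => x xK _ [<-].
  by apply: aeW => x _ [<-].
have := leb_on_ae oOmega; apply: filterS2 ae_all => x xK Ox.
have /nbhs_ballP[e /= e0 xeU] : nbhs x Omega by exact: open_nbhs_nbhs.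
have [k ke] : exists k : nat, k.+1%:R^-1 < e / 2.
  have e20 : 0 < e / 2 by rewrite divr_gt0.
  have [k _ hk] := near_infty_natSinv_lt (PosNum e20).
  by exists k; exact: hk k (leqnn k).
have qP i : exists q : rat, `|x 0 i - ratr q| < k.+1%:R^-1.
  have [|q] := @rat_in_itvoo R (x 0 i - k.+1%:R^-1) (x 0 i + k.+1%:R^-1).
    by rewrite ltrD2l gt0_cp// invr_gt0.
  by rewrite in_itv/= => qx; exists q; rewrite distrC ltr_distl.
have [q Hq] := choice qP.
pose qk := ([ffun i => q i], k) : ({ffun 'I_d -> rat} * nat)%type.
apply: (xK (pickle qk) qk); first exact: pickleK.
- move=> y yc; apply: xeU; split=> [|i j]; [exact: e0|rewrite ord1].
  have := yc j; rewrite !mxE /= ffunE -ler_distl => yq.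
  rewrite -ball_normE /ball_ /=.
  rewrite (le_lt_trans (ler_distD (ratr (q j)) _ _))// (splitr e) ltrD//.
    exact: lt_trans (Hq j) ke.
  by rewrite distrC (le_lt_trans yq).
- by move=> i; rewrite !mxE /= ffunE -ltr_distl.
Qed.

End fundamental_lemma.

(** * Weak derivatives *)

Section weak_derivatives.
Variables (R : realType) (d : nat) (Omega : set 'rV[R]_d) (oOmega : open Omega).
Local Notation mu := (leb_on oOmega).
Local Notation L2 := (L2 oOmega).
Local Notation e i := (delta_mx 0 i : 'rV[R]_d).
Implicit Types phi chi : 'rV[R]_d -> R.

Lemma test_function_sub phi psi : smooth psi ->
  [set x | psi x != 0] `<=` closure [set x | phi x != 0] ->
  test_function Omega phi -> test_function Omega psi.
Proof.
move=> spsi sub [_ cphi phiO].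
have {}sub : closure [set x | psi x != 0] `<=` closure [set x | phi x != 0].
  have /closure_id -> : closed (closure [set x | phi x != 0]).
    exact: closed_closure.
  exact: closureS.
split=> //; last exact: subset_trans phiO.
apply: (@subclosed_compact _ _ (closure [set x | phi x != 0])) => //.
exact: closed_closure.
Qed.

Lemma test_functionM chi phi : smooth chi -> test_function Omega phi ->
  test_function Omega (fun x => chi x * phi x).
Proof.
move=> schi tphi; apply: test_function_sub (tphi).
  by apply: smoothM => //; have [] := tphi.
by move=> x /=; rewrite mulf_eq0 negb_or => /andP[_ ?]; exact: subset_closure.
Qed.

(** Off the support of phi the function vanishes in a neighbourhood, so that its
derivatives vanish too. *)
Lemma test_function_derive phi i : test_function Omega phi ->
  test_function Omega (fun x => 'D_(e i) phi x).
Proof.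
move=> tphi; apply: test_function_sub (tphi).
  by apply: smooth_derive; have [] := tphi.
move=> x /=; apply: contra_neqP => nx.
have : \forall y \near x, (cst 0 : _ -> R) y = phi y.
  have : open_nbhs x (~` closure [set x | phi x != 0]).
    by split=> //; apply: closed_openC; exact: closed_closure.
  move=> /open_nbhs_nbhs; apply: filterS => y ny.
  apply/esym/eqP; apply/negPn/negP => py; apply: ny; exact: subset_closure.
by move=> /near_eq_derive <-; rewrite derive_cst.
Qed.

Lemma test_function_bounded phi : test_function Omega phi ->
  exists M, forall x, `|phi x| <= M.
Proof.
move=> [sphi cphi _].
have : compact (phi @` closure [set x | phi x != 0]).
  apply: continuous_compact cphi.
  by apply: continuous_subspaceT; exact: smooth_continuous.
move=> /compact_bounded[M [_ hM]]; exists `|M + 1| => x.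
have [->|px] := eqVneq (phi x) 0; first by rewrite normr0.
apply: le_trans (ler_norm _); apply: (hM (M + 1)); first by rewrite ltrDl.
by exists x => //; exact: subset_closure.
Qed.

Lemma integrable_mul_test (w : L2) phi : (mu setT < +oo)%E ->
  test_function Omega phi -> mu.-integrable setT (fun x => (w x * phi x)%:E).
Proof.
move=> mufin tphi; have [M hM] := test_function_bounded tphi.
have := integrableZl measurableT M (L2_integrable w mufin).
apply: le_integrable => //.
  apply/measurable_EFinP; apply: measurable_funM => //.
  by apply: continuous_measurable_rV; apply: smooth_continuous; have [] := tphi.
move=> x _; rewrite lee_fin !normrM mulrC ler_wpM2r//.
by apply: le_trans (hM x) _; exact: ler_norm.
Qed.

(** The product rule: to test the derivative of chi * w against phi, test that of
w against chi * phi. *)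
Lemma weak_partialM chi (i : 'I_d) (w g v h : L2) : (mu setT < +oo)%E ->
  smooth chi ->
  (forall x, v x = chi x * w x) ->
  (forall x, h x = chi x * g x + 'D_(e i) chi x * w x) ->
  weak_partial i w g -> weak_partial i v h.
Proof.
move=> mufin schi vE hE wg phi tphi.
have sphi : smooth phi by have [] := tphi.
have tcp := test_functionM schi tphi.
have tdp := test_functionM (smooth_derive i schi) tphi.
have := wg _ tcp; rewrite /inner => E.
transitivity (\int[mu]_x (w x * 'D_(e i) (fun x => chi x * phi x) x
    - w x * ('D_(e i) chi x * phi x))).
  apply: eq_Rintegral => x _; rewrite vE deriveM; last 2 first.
  - exact: smooth_derivable.
  - exact: smooth_derivable.
  by rewrite /GRing.scale/=; ring.
rewrite RintegralB//; last 2 first.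
- exact/integrable_mul_test/test_function_derive.
- exact: integrable_mul_test.
rewrite E -opprD -RintegralD//; last 2 first.
- exact: integrable_mul_test.
- exact: integrable_mul_test.
by congr (- _); apply: eq_Rintegral => x _; rewrite hE; ring.
Qed.

Lemma weak_gradient_unique (w : L2) (G H : 'I_d -> L2) : (mu setT < +oo)%E ->
  weak_gradient w G -> weak_gradient w H ->
  forall i, {ae mu, forall x, G i x = H i x}.
Proof.
move=> mufin wG wH i.
have : {ae mu, forall x, (G i - H i : L2) x = 0}.
  apply: fundamental_lemma => // phi tphi.
  rewrite /inner.
  transitivity (\int[mu]_x (G i x * phi x - H i x * phi x)).
    by apply: eq_Rintegral => x _; rewrite -mulrBl.
  rewrite RintegralB//; [|exact: integrable_mul_test..].
  have := wG i _ tphi; rewrite (wH i _ tphi) /inner => /oppr_inj ->.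
  by rewrite subrr.
by apply: filterS => x /eqP; rewrite subr_eq0 => /eqP.
Qed.

Lemma nablaP (w : L2) : H1 w -> weak_gradient w (nabla w).
Proof. by move=> w1; exact: xgetPex. Qed.

(** The integrand of the energy uses a weak gradient selected by a choice
operator; any weak gradient may replace it almost everywhere. *)
Lemma sqr_nablaE (w : L2) (G : 'I_d -> L2) : (mu setT < +oo)%E ->
  weak_gradient w G ->
  {ae mu, forall x, sqr_nabla w x = \sum_(i < d) G i x ^+ 2}.
Proof.
move=> mu_fin wG.
have wn : weak_gradient w (nabla w) by apply: nablaP; exists G.
have : {ae mu, forall x, forall i, nabla w i x = G i x}.
  by apply: filter_forall => i; exact: (weak_gradient_unique mu_fin wn wG).
by apply: filterS => x h; apply: eq_bigr => i _; rewrite h.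
Qed.

End weak_derivatives.

(** * Integrals of functions of the first coordinate *)

Section slab_integrals.
Variables (R : realType) (m : nat).
Local Notation d := m.+1.
Variables (Omega : set 'rV[R]_d) (oOmega : open Omega).
Local Notation mu := (leb_on oOmega).
Local Notation lambda := (@lebesgue_measure R).

(** Omega lies in the cube of half-side L, whose sections orthogonal to the first
axis have measure (2 L)^m: the law of the first coordinate is at most that
multiple of the Lebesgue measure. *)
Lemma leb_on_slab (L : R) (B : set R) : 0 <= L ->
  (forall x, Omega x -> forall i, `|x 0 i| <= L) -> measurable B ->
  (mu ((fun x : 'rV[R]_d => x 0%R ord0) @^-1` B) <= ((2 * L) ^+ m)%:E * lambda B)%E.
Proof.
move=> L0 OL mB.
pose b : 'rV[R]_m := const_mx L.
have bE : lebesgue_rV R m (cbox (- b) b) = ((2 * L) ^+ m)%:E.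
  rewrite [LHS]lebesgue_rV_box => [|i].
    rewrite (eq_bigr (fun=> 2 * L)) ?prodr_const ?card_ord// => i _.
    by rewrite !mxE opprK mulr_natl mulr2n.
  by rewrite !mxE -subr_ge0 opprK addr_ge0.
rewrite -bE muleC.
have mcB : measurable ((fun x : 'rV[R]_d => x 0%R ord0) @^-1` B).
  by rewrite -[X in measurable X]setTI; exact: measurable_coord.
rewrite -(@product_measure1E _ _ _ _ _ lambda (lebesgue_rV R m) B) //; last first.
  exact: measurable_cbox.
rewrite /= /mrestr /= /lebesgue_rV_step /pushforward.
apply: le_measure.
- rewrite inE -[X in measurable X]setTI; apply: measurable_rV_cons => //.
  by apply: measurableI => //; exact: open_measurable_rV.
- by rewrite inE; apply: measurableX => //; exact: measurable_cbox.
- move=> [t v] /= [Bt Ov]; split => /=.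
    move: Bt; rewrite /rV_cons (_ : ord0 = @lshift 1 m ord0); last exact/val_inj.
    by rewrite (@row_mxEl _ 1 1 m) mxE eqxx mulr1n.
  move=> i; rewrite !mxE -ler_norml.
  have := OL _ Ov (@rshift 1 m i).
  by rewrite /rV_cons /= (@row_mxEr _ 1 1 m).
Qed.

(** Change of variables along the first coordinate, followed by the comparison of
measures [leb_on_slab].  The restriction F of f to [-L, L] has the same integral
over Omega as f and is integrated on the whole line. *)
Lemma le_slab_integral (L : R) (f : R -> R) : 0 <= L ->
  (forall x, Omega x -> forall i, `|x 0 i| <= L) ->
  (forall t, 0 <= f t) -> measurable_fun setT f ->
  (\int[mu]_x (f (x 0%R ord0))%:E <=
    ((2 * L) ^+ m)%:E * \int[lambda]_(t in `[(- L)%R, L]%classic) (f t)%:E)%E.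
Proof.
move=> L0 OL f0 mf.
pose F := (fun t => (f t)%:E) \_ `[- L, L]%classic.
have F0 t : (0 <= F t)%E by rewrite /F patchE; case: ifP => // _; rewrite lee_fin.
have mF : measurable_fun setT (F : measurableTypeR R -> \bar R).
  apply/(measurable_restrictT _ (measurable_itv _)).
  by apply/measurable_EFinP; exact: measurable_funTS.
have mc : measurable_fun setT (fun x : 'rV[R]_d => x 0 ord0 : measurableTypeR R).
  exact: measurable_coord.
have K0 : 0 <= (2 * L) ^+ m by rewrite exprn_ge0// mulr_ge0.
rewrite [leLHS](_ : _ = \int[mu]_x F (x 0%R ord0))%E; last first.
  apply: ge0_ae_eq_integral => //.
  - by apply/measurable_EFinP; exact: (measurableT_comp mf mc).
  - exact: (measurableT_comp mF mc).
  - by move=> x _; rewrite lee_fin.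
  - have := leb_on_ae oOmega; apply: filterS => x /OL /(_ ord0).
    rewrite ler_norml => xL _; rewrite /F patchE ifT// inE/= in_itv/=.
    exact: xL.
pose nu : {measure set (measurableTypeR R) -> \bar R} :=
  measure_function_pushforward__canonical__measure_function_Measure mu mc.
pose Klambda : {measure set (measurableTypeR R) -> \bar R} :=
  mscale (NngNum K0) lambda.
rewrite [leLHS](_ : _ = \int[nu]_t F t)%E; last first.
  by rewrite ge0_integral_pushforward//; exact/measurable_funTS.
rewrite [X in (_ * X)%E]integral_mkcond.
have <- := ge0_integral_mscale lambda measurableT (NngNum K0) mF (fun t _ => F0 t).
apply: (@ge0_le_measure_integral _ (measurableTypeR R) R nu Klambda) => //.
by move=> B mB; exact: leb_on_slab.
Qed.

End slab_integrals.

(** * Logistic steps *)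

Section steps.
Variables (R : realType) (eps : R).
Hypothesis eps_gt0 : 0 < eps.
Implicit Types a b t : R.

(** The logistic function of (t - a) / eps, in the affine form required by
[smooth_ridge]. *)
Definition sigmoid_step a t : R := sigmoid (eps^-1 * t + - (eps^-1 * a)).

Lemma sigmoid_step_gt0 a t : 0 < sigmoid_step a t. Proof. exact: sigmoid_gt0. Qed.
Lemma sigmoid_step_lt1 a t : sigmoid_step a t < 1. Proof. exact: sigmoid_lt1. Qed.

Lemma sigmoid_step_le a b t : a <= b -> sigmoid_step b t <= sigmoid_step a t.
Proof.
by move=> ab; apply: sigmoid_le; rewrite lerD2l lerN2 ler_wpM2l// invr_ge0 ltW.
Qed.

Lemma is_derive_affine (c k t : R) : is_derive t (1 : R) (fun u : R => c * u + k) c.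
Proof.
rewrite (_ : (fun u => _) = (c *: (id : R -> R)) + cst k); last exact/funext.
by apply: is_derive_eq; rewrite addr0 [_ *: _]mulr1.
Qed.

Lemma is_derive_sigmoid_step a t :
  is_derive t (1 : R) (sigmoid_step a) (eps^-1 * (sigmoid_step a t * (1 - sigmoid_step a t))).
Proof.
rewrite mulrC; exact: (is_derive1_comp (is_derive_sigmoid _)
  (is_derive_affine eps^-1 (- (eps^-1 * a)) t)).
Qed.

Lemma continuous_sigmoid_step a : continuous (sigmoid_step a).
Proof.
move=> t; apply: differentiable_continuous; apply/derivable1_diffP.
by have [] := is_derive_sigmoid_step a t.
Qed.

(** The primitive of the logistic function. *)
Definition softplus (y : R) : R := ln (1 + expR y).

Lemma softplus_le y z : y <= z -> softplus y <= softplus z.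
Proof.
by move=> yz; rewrite ler_ln ?posrE ?addr_gt0 ?expR_gt0// lerD2l ler_expR.
Qed.

Lemma softplus_lip y z : y <= z -> softplus z - softplus y <= z - y.
Proof.
move=> yz; rewrite lerBlDr -[z - y]expRK -lnM ?posrE ?addr_gt0 ?expR_gt0//.
rewrite ler_ln ?posrE ?mulr_gt0 ?addr_gt0 ?expR_gt0//.
rewrite mulrDr mulr1 -expRD subrK lerD2r.
by rewrite -expR0 ler_expR subr_ge0.
Qed.

Lemma is_derive_softplus (y : R) : is_derive y (1 : R) softplus (sigmoid y).
Proof.
have p : 0 < 1 + expR y by rewrite addr_gt0// expR_gt0.
have d : is_derive y (1 : R) (fun t => 1 + expR t) (expR y).
  have := is_deriveD (is_derive_cst (1 : R) y (1 : R)) (is_derive_expR y).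
  by rewrite add0r.
have h := @is_derive1_comp R (@ln R) _ y _ _ (is_derive1_ln p) d.
rewrite (_ : sigmoid y = (1 + expR y)^-1 * expR y) //.
rewrite /sigmoid expRN; field; rewrite ?gt_eqF ?addr_gt0 ?expR_gt0//.
Qed.

Lemma integral_deriv (f F : R -> R) (L : R) : 0 < L ->
  (forall t, is_derive t (1 : R) F (f t)) -> continuous f ->
  (\int[@lebesgue_measure R]_(t in `[(- L)%R, L]%classic) (f t)%:E = (F L - F (- L))%:E)%E.
Proof.
move=> L0 dF cf.
have cF : continuous F.
  move=> t; apply: differentiable_continuous; apply/derivable1_diffP.
  by have [] := dF t.
apply: continuous_FTC2.
- by rewrite gtrN.
- exact: continuous_subspaceT.
- split.
  + by move=> t _; have [] := dF t.
  + by apply: cvg_at_right_filter; exact: cF.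
  + by apply: cvg_at_left_filter; exact: cF.
- by move=> t _; rewrite derive1E (@derive_val _ _ _ _ _ _ _ (dF t)).
Qed.

(** By the logistic equation the integrand is eps times the derivative of a
function with values in ]0, 1[. *)
Lemma integral_step_var (a L : R) : 0 < L ->
  (\int[@lebesgue_measure R]_(t in `[(- L)%R, L]%classic)
     (sigmoid_step a t * (1 - sigmoid_step a t))%:E <= eps%:E)%E.
Proof.
move=> L0.
have dF t : is_derive t (1 : R) (fun t => eps * sigmoid_step a t)
    (sigmoid_step a t * (1 - sigmoid_step a t)).
  have := is_deriveZ eps (is_derive_sigmoid_step a t).
  by rewrite [X in is_derive _ _ _ X]mulVKf// gt_eqF.
have cf : continuous (fun t => sigmoid_step a t * (1 - sigmoid_step a t)).
  move=> t; apply: cvgM; first exact: continuous_sigmoid_step.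
  by apply: cvgB; [exact: cvg_cst|exact: continuous_sigmoid_step].
rewrite (integral_deriv L0 dF cf) lee_fin -mulrBr -[leRHS]mulr1.
rewrite ler_wpM2l// ?(ltW eps_gt0)//.
by have := sigmoid_step_gt0 a (- L); have := sigmoid_step_lt1 a L; lra.
Qed.

(** The two steps have primitives that are translates of each other by b - a, and
these primitives are 1-Lipschitz and nondecreasing. *)
Lemma integral_step_diff (a b L : R) : 0 < L -> a <= b ->
  (\int[@lebesgue_measure R]_(t in `[(- L)%R, L]%classic)
     (sigmoid_step a t - sigmoid_step b t)%:E <= (b - a)%:E)%E.
Proof.
move=> L0 ab.
pose F a t := eps * softplus (eps^-1 * t + - (eps^-1 * a)).
have dF a' t : is_derive t (1 : R) (F a') (sigmoid_step a' t).
  have := is_deriveZ eps (is_derive1_comp (is_derive_softplus _)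
    (is_derive_affine eps^-1 (- (eps^-1 * a')) t)).
  by rewrite [X in is_derive _ _ _ X]mulrC mulfVK ?gt_eqF.
have dFab t : is_derive t (1 : R) (fun t => F a t - F b t) (sigmoid_step a t - sigmoid_step b t).
  exact: is_deriveB.
have cf : continuous (fun t => sigmoid_step a t - sigmoid_step b t).
  by move=> t; apply: cvgB; exact: continuous_sigmoid_step.
rewrite (integral_deriv L0 dFab cf) lee_fin.
have ab' t : eps^-1 * t + - (eps^-1 * b) <= eps^-1 * t + - (eps^-1 * a).
  by rewrite lerD2l lerN2 ler_wpM2l// invr_ge0 ltW.
have le1 : F a L - F b L <= b - a.
  rewrite -mulrBr mulrC -ler_pdivlMr//.
  apply: le_trans (softplus_lip (ab' _)) _.
  by rewrite le_eqVlt; apply/orP; left; apply/eqP; field; rewrite gt_eqF.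
have le2 : 0 <= F a (- L) - F b (- L).
  by rewrite -mulrBr mulr_ge0 ?(ltW eps_gt0)// subr_ge0; exact: softplus_le.
lra.
Qed.

End steps.

(** * The energy of a cut-off function *)

(** The pointwise estimate at the heart of the proof.  Here sa and sb are the
values of the two logistic steps, w and g those of a function and of its first
partial derivative, q is the sum of the squares of the other partial derivatives,
and theta = sa - sb.  The left-hand side is the energy density of
v = (1 - theta) w plus theta / 2 times that of w; the right-hand side is the
energy density of w plus a multiple of the potential energy of the two steps.

The derivative of theta factors as eps * theta' = theta * m with m = 1 - sa - sb,
so every error term carries a factor theta.  Now theta * m^2 and
theta * (1 - theta) are bounded by S = sa (1 - sa) + sb (1 - sb), because theta
is small unless sa is large and sb small, in which case m and 1 - theta are
small.  The mixed term theta * v * m * g is absorbed into eps * theta * g^2 by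
Young's inequality, which is why only theta / 2 of the density of w is gained. *)
Lemma cutoff_density_le (R : realType) (eps sa sb w g q theta dtheta v : R) :
  0 < eps -> 0 < sb -> sb <= sa -> sa < 1 -> 0 <= w <= 1 -> 0 <= q ->
  theta = sa - sb ->
  dtheta = eps^-1 * (sa * (1 - sa)) - eps^-1 * (sb * (1 - sb)) ->
  v = (1 - theta) * w ->
  eps / 2 * (((1 - theta) * g - dtheta * w) ^+ 2 + (1 - theta) ^+ 2 * q)
    + eps^-1 * (v * (1 - v))
    + theta / 2 * (eps / 2 * (g ^+ 2 + q) + eps^-1 * (w * (1 - w)))
  <= eps / 2 * (g ^+ 2 + q) + eps^-1 * (w * (1 - w))
    + 5 / 2 * (eps^-1 * (sa * (1 - sa)) + eps^-1 * (sb * (1 - sb))).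
Proof.
move=> e0 sb0 sba sa1 /andP[w0 w1] q0 thE dthE vE.
have p0 : 0 < eps^-1 by rewrite invr_gt0.
have ep : eps * eps^-1 = 1 by rewrite divff// gt_eqF.
(* With p a variable subject to eps * p = 1, all terms become polynomial. *)
move: (eps^-1) p0 ep dthE => p p0 ep dthE.
pose m := 1 - sa - sb; pose S := sa * (1 - sa) + sb * (1 - sb).
have dE : dtheta = p * (theta * m) by rewrite dthE thE /m; ring.
have th0 : 0 <= theta by rewrite thE subr_ge0.
have th1 : theta <= 1 by rewrite thE; lra.
have Hm : m ^+ 2 <= (1 - sa) + sb by rewrite /m; nra.
have Hth : theta * ((1 - sa) + sb) <= S by rewrite thE /S; nra.
have H1 : theta * m ^+ 2 <= S by apply: le_trans Hth; rewrite ler_wpM2l.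
have H2 : theta * (1 - theta) <= S.
  by apply: le_trans Hth; rewrite ler_wpM2l// thE; lra.
have k0 : 0 <= v <= 1 by rewrite vE; apply/andP; split; nra.
have young : 0 <= eps / 4 * g ^+ 2 + v * m * g + p * m ^+ 2.
  have -> : eps / 4 * g ^+ 2 + v * m * g + p * m ^+ 2 =
      eps / 4 * (g + 2 * p * v * m) ^+ 2 + p * (1 - v ^+ 2) * m ^+ 2.
    transitivity (eps / 4 * g ^+ 2 + (eps * p) * v * m * g
      + (eps * p) * (p * v ^+ 2 * m ^+ 2) + p * (1 - v ^+ 2) * m ^+ 2); last by field.
    by rewrite ep; ring.
  by rewrite addr_ge0// mulr_ge0 ?sqr_ge0//; [lra|rewrite mulr_ge0 ?(ltW p0)//; nra].
have G1 : eps / 2 * ((1 - theta) * g - dtheta * w) ^+ 2 =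
    eps / 2 * (1 - theta) ^+ 2 * g ^+ 2 - theta * (v * m * g)
    + p / 2 * (theta ^+ 2 * m ^+ 2 * w ^+ 2).
  rewrite dE vE.
  transitivity (eps / 2 * (1 - theta) ^+ 2 * g ^+ 2
    - (eps * p) * (theta * ((1 - theta) * w * m * g))
    + (eps * p) * (p / 2 * (theta ^+ 2 * m ^+ 2 * w ^+ 2))); first by field.
  by rewrite ep; ring.
have G2 : (1 - theta) ^+ 2 <= 1 - theta by nra.
have G3 : theta ^+ 2 * m ^+ 2 * w ^+ 2 <= S.
  apply: le_trans H1.
  have : theta * w ^+ 2 <= 1 by nra.
  have : 0 <= theta * m ^+ 2 by rewrite mulr_ge0 ?sqr_ge0.
  by nra.
have P1 : v * (1 - v) <= (1 - theta) * (w * (1 - w)) + S.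
  have -> : v * (1 - v) = (1 - theta) ^+ 2 * (w * (1 - w)) + theta * (1 - theta) * w.
    by rewrite vE; ring.
  apply: lerD; first by rewrite ler_wpM2r// mulr_ge0// subr_ge0.
  by apply: le_trans H2; rewrite ler_piMr// mulr_ge0// subr_ge0.
have P2 := ler_wpM2l (ltW p0) P1.
have Y2 : 0 <= theta * (eps / 4 * g ^+ 2) + theta * (v * m * g) + p * (theta * m ^+ 2).
  have := mulr_ge0 th0 young.
  by rewrite !mulrDr [theta * (p * _)]mulrCA.
have Q1 := ler_wpM2l (ltW p0) H1.
have Q3 := ler_wpM2l (ltW p0) G3.
have e20 : 0 <= eps / 2 by lra.
have R1 : eps / 2 * (1 - theta) ^+ 2 * g ^+ 2 <= eps / 2 * (1 - theta) * g ^+ 2.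
  by rewrite ler_wpM2r ?sqr_ge0// ler_wpM2l.
have R2 : eps / 2 * (1 - theta) ^+ 2 * q <= eps / 2 * (1 - theta) * q.
  by rewrite ler_wpM2r// ler_wpM2l.
have R3 : 0 <= theta * eps * q by rewrite !mulr_ge0// ltW.
have R4 : 0 <= theta * p * (w * (1 - w)).
  by rewrite !mulr_ge0// ?subr_ge0// ltW.
rewrite mulrDr G1; rewrite /S in H1 H2 G3 Q1 Q3 P2 *.
lra.
Qed.

(** * The energy density *)

Section energy.
Variables (R : realType) (d : nat) (Omega : set 'rV[R]_d) (oOmega : open Omega).
Local Notation mu := (leb_on oOmega).
Local Notation L2 := (L2 oOmega).
Hypothesis mu_fin : (mu setT < +oo)%E.

(** With the absolute value the density is nonnegative and finite at every point,
also where a unit valued function leaves the unit interval on a null set. *)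
Definition energy_density (eps : R) (w : L2) (x : 'rV[R]_d) : R :=
  eps / 2 * sqr_nabla w x + eps^-1 * `|w x * (1 - w x)|.

Lemma sqr_nabla_ge0 (w : L2) x : 0 <= sqr_nabla w x.
Proof. by apply: sumr_ge0 => i _; rewrite sqr_ge0. Qed.

Lemma energy_density_ge0 eps (w : L2) x : 0 < eps -> 0 <= energy_density eps w x.
Proof.
move=> e0; rewrite addr_ge0// mulr_ge0 ?sqr_nabla_ge0 ?invr_ge0 ?(ltW e0)//.
by rewrite divr_ge0// ltW.
Qed.

Lemma integrable_sqr_nabla (w : L2) :
  mu.-integrable setT (fun x => (sqr_nabla w x)%:E).
Proof.
rewrite (_ : (fun x => _) = fun x => (\sum_(i < d) (nabla w i x ^+ 2)%:E)%E).
  by apply: integrable_sum => // i _; exact: L2_sqr_integrable.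
by apply/funext => x; rewrite sumEFin.
Qed.

Lemma integrable_double_well (w : L2) :
  mu.-integrable setT (fun x => (w x * (1 - w x))%:E).
Proof.
rewrite (_ : (fun x => _) = fun x => ((w x)%:E - (w x ^+ 2)%:E)%E).
  by apply: integrableB => //; [exact: L2_integrable|exact: L2_sqr_integrable].
by apply/funext => x; rewrite -EFinB; congr EFin; ring.
Qed.

Lemma integrable_energy_density eps (w : L2) :
  mu.-integrable setT (fun x => (energy_density eps w x)%:E).
Proof.
rewrite (_ : (fun x => _) = fun x => ((eps / 2)%:E * (sqr_nabla w x)%:E +
    eps^-1%:E * `|(w x * (1 - w x))%:E|)%E).
  apply: integrableD => //; apply: integrableZl => //.
    exact: integrable_sqr_nabla.
  exact/integrable_abse/integrable_double_well.
by apply/funext => x.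
Qed.

Lemma measurable_Psi : measurable_fun setT (@Psi R).
Proof.
apply: measurable_fun_ifT => //.
  by apply: measurable_and; apply: measurable_fun_ler.
by apply/measurable_EFinP; apply: measurable_funM => //; exact: measurable_funB.
Qed.

Lemma energyE eps (w : L2) : 0 < eps -> H1 w -> unit_valued w ->
  energy eps w = (\int[mu]_x (energy_density eps w x)%:E)%E.
Proof.
move=> e0 w1 wu; rewrite /energy mem_set//.
have mw : measurable_fun setT w by [].
apply: ge0_ae_eq_integral => //.
- apply: emeasurable_funD.
    apply/measurable_EFinP; apply: measurable_funM => //.
    by apply/measurable_EFinP; exact: (measurable_int mu (integrable_sqr_nabla w)).
  apply: emeasurable_funM => //.
  exact: (measurableT_comp measurable_Psi mw).
- exact: (measurable_int mu (integrable_energy_density eps w)).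
- move=> x _; apply: adde_ge0.
    by rewrite lee_fin mulr_ge0 ?sqr_nabla_ge0// divr_ge0// ltW.
  apply: mule_ge0; first by rewrite lee_fin invr_ge0 ltW.
  rewrite /Psi; case: ifP => // /andP[h1 h2].
  by rewrite lee_fin mulr_ge0// subr_ge0.
- by move=> x _; rewrite lee_fin energy_density_ge0.
- apply: filterS wu => x /andP[h1 h2] _.
  by rewrite /Psi /energy_density h1 h2/= -EFinM -EFinD ger0_norm// mulr_ge0// subr_ge0.
Qed.

Lemma energy_fin eps (w : L2) : 0 < eps -> H1 w -> unit_valued w ->
  energy eps w \is a fin_num.
Proof.
move=> e0 w1 wu; rewrite energyE//.
by apply: integrable_fin_num => //; exact: integrable_energy_density.
Qed.

Lemma energy_ge0 eps (w : L2) : 0 < eps -> H1 w -> unit_valued w ->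
  (0 <= energy eps w)%E.
Proof.
by move=> e0 w1 wu; rewrite energyE// integral_ge0// => x _; rewrite lee_fin energy_density_ge0.
Qed.

End energy.

(** * Erasing a function in a slab *)

Section cutoff.
Variables (R : realType) (m : nat).
Local Notation d := m.+1.
Variables (Omega : set 'rV[R]_d) (oOmega : open Omega) (L : R).
Hypothesis L_gt0 : 0 < L.
Hypothesis OmegaL : forall x, Omega x -> forall i, `|x 0 i| <= L.
Local Notation mu := (leb_on oOmega).
Local Notation L2 := (L2 oOmega).
Local Notation e i := (delta_mx 0 i : 'rV[R]_d).
Hypothesis mu_fin : (mu setT < +oo)%E.
Variables (eps : R).
Hypothesis eps_gt0 : 0 < eps.

Let K : R := (2 * L) ^+ m.

Let K_ge0 : 0 <= K.
Proof. by rewrite exprn_ge0// mulr_ge0// ltW. Qed.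

(** A smooth version of the indicator of [a, b]. *)
Definition slab_bump (a b t : R) : R := sigmoid_step eps a t - sigmoid_step eps b t.

Lemma slab_bump_ge0 a b t : a <= b -> 0 <= slab_bump a b t.
Proof. by move=> ab; rewrite subr_ge0 sigmoid_step_le. Qed.

Lemma slab_bump_le1 a b t : slab_bump a b t <= 1.
Proof.
by have := sigmoid_step_lt1 eps a t; have := sigmoid_step_gt0 eps b t; rewrite /slab_bump; lra.
Qed.

Definition slab_cutoff (a b : R) (x : 'rV[R]_d) : R := 1 - slab_bump a b (x 0 ord0).

Lemma slab_cutoffE a b : slab_cutoff a b =
  fun x : 'rV[R]_d => 1 + (-1 * sigmoid_step eps a (x 0 ord0) + sigmoid_step eps b (x 0 ord0)).
Proof. by apply/funext => x; rewrite /slab_cutoff /slab_bump; ring. Qed.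

Lemma smooth_sigmoid_step a : smooth (fun x : 'rV[R]_d => sigmoid_step eps a (x 0 ord0)).
Proof. exact: (smooth_ridge ord0 eps^-1 (- (eps^-1 * a)) (@smooth1_sigmoid R)). Qed.

Lemma smooth_slab_cutoff a b : smooth (slab_cutoff a b).
Proof.
rewrite slab_cutoffE; apply: smoothD; first exact: smooth_cst.
apply: smoothD; last exact: smooth_sigmoid_step.
by apply: smoothM; [exact: smooth_cst|exact: smooth_sigmoid_step].
Qed.

Definition slab_bump_deriv (a b t : R) : R :=
  eps^-1 * (sigmoid_step eps a t * (1 - sigmoid_step eps a t))
  - eps^-1 * (sigmoid_step eps b t * (1 - sigmoid_step eps b t)).

Lemma derive_sigmoid_step a i (x : 'rV[R]_d) :
  'D_(e i) (fun x : 'rV[R]_d => sigmoid_step eps a (x 0 ord0)) x =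
  (ord0 == i)%:R * (eps^-1 *
    (sigmoid_step eps a (x 0 ord0) * (1 - sigmoid_step eps a (x 0 ord0)))).
Proof.
have D := @is_derive_sigmoid R (eps^-1 * x 0 ord0 + - (eps^-1 * a)).
have [d1 d2] := D.
have := @is_derive_ridge R d (@sigmoid R) ord0 i eps^-1 (- (eps^-1 * a)) x d1.
move=> /(@derive_val _ _ _ _ _ _ _) ->.
by rewrite derive1E d2 /sigmoid_step; ring.
Qed.

Lemma derive_slab_cutoff a b i x :
  'D_(e i) (slab_cutoff a b) x = - ((ord0 == i)%:R * slab_bump_deriv a b (x 0 ord0)).
Proof.
have sNa := smoothM (@smooth_cst R d (-1)) (smooth_sigmoid_step a).
have D1 := @smooth_derivable _ _ _ x i (@smooth_cst R d 1).
have D2 := @smooth_derivable _ _ _ x i (smooth_sigmoid_step a).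
have D3 := @smooth_derivable _ _ _ x i sNa.
have D4 := @smooth_derivable _ _ _ x i (smooth_sigmoid_step b).
have D5 := @smooth_derivable _ _ _ x i (smoothD sNa (smooth_sigmoid_step b)).
rewrite slab_cutoffE (deriveD D1 D5) derive_cst add0r (deriveD D3 D4) (deriveMl _ D2).
by rewrite !derive_sigmoid_step /slab_bump_deriv; ring.
Qed.

Lemma slab_bump_mass a b : a <= b ->
  (\int[mu]_x (slab_bump a b (x 0%R ord0))%:E <= (K * (b - a))%:E)%E.
Proof.
move=> ab.
have mt : measurable_fun setT (slab_bump a b).
  by apply: measurable_funB; apply: continuous_measurable_fun;
    exact: continuous_sigmoid_step.
apply: le_trans (le_slab_integral oOmega (ltW L_gt0) OmegaL
  (fun t => slab_bump_ge0 t ab) mt) _.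
by rewrite EFinM lee_wpmul2l ?lee_fin// integral_step_diff.
Qed.

(** The potential of a logistic step, which is also eps times its derivative. *)
Definition step_layer (a t : R) : R := sigmoid_step eps a t * (1 - sigmoid_step eps a t).

Lemma step_layer_ge0 a t : 0 <= step_layer a t.
Proof. by rewrite mulr_ge0 ?subr_ge0 ?ltW ?sigmoid_step_gt0 ?sigmoid_step_lt1. Qed.

Lemma measurable_step_layer a : measurable_fun setT (step_layer a).
Proof.
have ms : measurable_fun setT (sigmoid_step eps a).
  by apply: continuous_measurable_fun; exact: continuous_sigmoid_step.
by apply: measurable_funM => //; exact: measurable_funB.
Qed.

(** The potential energy of a transition layer is bounded independently of eps. *)
Lemma step_layer_mass a :
  (\int[mu]_x (eps^-1 * step_layer a (x 0%R ord0))%:E <= K%:E)%E.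
Proof.
have ml := measurable_step_layer a.
have h := le_slab_integral oOmega (ltW L_gt0) OmegaL (step_layer_ge0 a) ml.
have mc := @measurable_coord R d ord0.
have mlc : measurable_fun setT (fun x : 'rV[R]_d => step_layer a (x 0 ord0)).
  exact: (measurableT_comp ml mc).
under eq_integral do rewrite EFinM.
rewrite ge0_integralZl//; last 3 first.
- by apply/measurable_EFinP.
- by move=> x _; rewrite lee_fin step_layer_ge0.
- by rewrite lee_fin invr_ge0 ltW.
apply: le_trans (lee_wpmul2l _ h) _; first by rewrite lee_fin invr_ge0 ltW.
rewrite muleCA -[leRHS]mule1 lee_wpmul2l ?lee_fin//.
apply: le_trans (lee_wpmul2l _ (integral_step_var eps_gt0 a L_gt0)) _.
  by rewrite lee_fin invr_ge0 ltW.
by rewrite -EFinM mulVf ?gt_eqF.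
Qed.

Lemma slab_cutoff_itv a b x : a <= b -> 0 <= slab_cutoff a b x <= 1.
Proof.
move=> ab; rewrite /slab_cutoff subr_ge0 slab_bump_le1/= lerBlDr lerDl.
exact: slab_bump_ge0.
Qed.

Lemma slab_bump_deriv_le a b t : `|slab_bump_deriv a b t| <= eps^-1.
Proof.
have p0 : 0 < eps^-1 by rewrite invr_gt0.
have h c : 0 <= sigmoid_step eps c t * (1 - sigmoid_step eps c t) <= 1.
  have := sigmoid_step_lt1 eps c t; have := sigmoid_step_gt0 eps c t => h0 h1.
  by apply/andP; split; nra.
rewrite /slab_bump_deriv -mulrBr normrM (gtr0_norm p0) -[leRHS]mulr1 ler_wpM2l ?(ltW p0)//.
by have /andP[? ?] := h a; have /andP[? ?] := h b; rewrite ler_norml; apply/andP; split; lra.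
Qed.

Lemma cutoff_weak_gradient a b (w v : L2) : a <= b -> H1 w ->
  (forall x, v x = slab_cutoff a b x * w x) ->
  exists2 G : 'I_d -> L2, weak_gradient v G &
    forall i x, G i x = slab_cutoff a b x * nabla w i x
      - (ord0 == i)%:R * slab_bump_deriv a b (x 0 ord0) * w x.
Proof.
move=> ab w1 vE.
have mchi : measurable_fun setT (slab_cutoff a b).
  by apply: continuous_measurable_rV; apply: smooth_continuous; exact: smooth_slab_cutoff.
have chi1 x : `|slab_cutoff a b x| <= 1.
  by have /andP[h0 h1] := slab_cutoff_itv x ab; rewrite ger0_norm.
have mD i : measurable_fun setT (fun x => 'D_(e i) (slab_cutoff a b) x).
  apply: continuous_measurable_rV; apply: smooth_continuous; apply: smooth_derive.
  exact: smooth_slab_cutoff.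
have D1 i x : `|'D_(e i) (slab_cutoff a b) x| <= eps^-1.
  rewrite derive_slab_cutoff normrN normrM; apply: le_trans (slab_bump_deriv_le a b (x 0 ord0)).
  by rewrite ler_piMl//; case: eqP; rewrite /= ?normr1 ?normr0.
have /choice[G GE] : forall i, exists u : L2, forall x,
    u x = slab_cutoff a b x * nabla w i x + 'D_(e i) (slab_cutoff a b) x * w x.
  move=> i; have [u1 u1E] := L2_mul_bounded (nabla w i) mchi chi1.
  have [u2 u2E] := L2_mul_bounded w (mD i) (D1 i).
  by exists (u1 + u2) => x; rewrite -u1E -u2E.
exists G => [i|i x]; last by rewrite GE derive_slab_cutoff mulNr.
exact: (weak_partialM mu_fin (smooth_slab_cutoff a b) vE (GE i) (nablaP w1 i)).
Qed.

(** The competitor is slab_cutoff a b * w.  Both estimates are pointwise: the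
first one follows from (v - w)^2 <= slab_bump, the second one from
[cutoff_density_le], whose error term has integral at most
5 / 2 * (K + K) by [step_layer_mass]. *)
Lemma cutoff_competitor a b (w : L2) : a <= b -> H1 w -> unit_valued w ->
  exists v : L2, [/\ H1 v, unit_valued v, L2norm (v - w) ^+ 2 <= K * (b - a) &
    (energy eps v + \int[mu]_x (slab_bump a b (x 0%R ord0) / 2 * energy_density eps w x)%:E
      <= energy eps w + (5 * K)%:E)%E].
Proof.
move=> ab w1 wu.
have mchi : measurable_fun setT (slab_cutoff a b).
  by apply: continuous_measurable_rV; apply: smooth_continuous; exact: smooth_slab_cutoff.
have chi1 x : `|slab_cutoff a b x| <= 1.
  by have /andP[h0 h1] := slab_cutoff_itv x ab; rewrite ger0_norm.
have [v vE] := L2_mul_bounded w mchi chi1.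
have [G vG GE] := cutoff_weak_gradient ab w1 vE.
have v1 : H1 v by exists G.
have vu : unit_valued v.
  apply: filterS wu => x /andP[h0 h1]; have /andP[c0 c1] := slab_cutoff_itv x ab.
  by rewrite vE mulr_ge0//= mulr_ile1.
have mt : measurable_fun setT (fun x : 'rV[R]_d => slab_bump a b (x 0 ord0)).
  rewrite (_ : (fun x => _) = fun x => 1 - slab_cutoff a b x).
    exact: measurable_funB.
  by apply/funext => x; rewrite /slab_cutoff; ring.
have mdw := measurable_int mu (integrable_energy_density mu_fin eps w).
have mdv := measurable_int mu (integrable_energy_density mu_fin eps v).
exists v; split => //.
- rewrite -lee_fin L2norm_sqr; apply: le_trans (slab_bump_mass ab).
  apply: ae_ge0_le_integral => //.
  + by move=> x _; rewrite lee_fin sqr_ge0.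
  + exact: (measurable_int mu (L2_sqr_integrable _)).
  + by move=> x _; rewrite lee_fin slab_bump_ge0.
  + exact/measurable_EFinP.
  + apply: filterS wu => x /andP[h0 h1] _; rewrite lee_fin.
    have -> : (v - w) x = - (slab_bump a b (x 0 ord0) * w x).
      by rewrite [LHS](_ : _ = v x - w x)// vE /slab_cutoff; ring.
    have t0 := slab_bump_ge0 (x 0 ord0) ab; have t1 := slab_bump_le1 a b (x 0 ord0).
    rewrite sqrrN exprMn; apply: (@le_trans _ _ (slab_bump a b (x 0 ord0) ^+ 2)).
      by rewrite ler_piMr ?sqr_ge0// expr_le1.
    by rewrite expr2 ler_piMl.
have p0 : 0 < eps^-1 by rewrite invr_gt0.
have ml c : measurable_fun setT (fun x : 'rV[R]_d => eps^-1 * step_layer c (x 0 ord0)).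
  apply: measurable_funM => //.
  exact: (measurableT_comp (measurable_step_layer c) (@measurable_coord R d ord0)).
have l0 c t : 0 <= eps^-1 * step_layer c t by rewrite mulr_ge0 ?step_layer_ge0// ltW.
have td0 (x : 'rV[R]_d) : 0 <= slab_bump a b (x 0 ord0) / 2 * energy_density eps w x.
  by rewrite mulr_ge0 ?energy_density_ge0// divr_ge0// slab_bump_ge0.
have mtd : measurable_fun setT (fun x : 'rV[R]_d =>
    (slab_bump a b (x 0%R ord0) / 2 * energy_density eps w x)%:E).
  apply/measurable_EFinP; apply: measurable_funM; first exact: measurable_funM.
  exact/measurable_EFinP.
have LM : (\int[mu]_x (5 / 2 * (eps^-1 * step_layer a (x 0%R ord0)
    + eps^-1 * step_layer b (x 0%R ord0)))%:E <= (5 * K)%:E)%E.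
  under eq_integral do rewrite EFinM EFinD.
  rewrite ge0_integralZl//; last 2 first.
  - by apply: emeasurable_funD; exact/measurable_EFinP.
  - by move=> x _; rewrite lee_fin addr_ge0.
  rewrite ge0_integralD//; last 4 first.
  - by move=> x _; rewrite lee_fin.
  - exact/measurable_EFinP.
  - by move=> x _; rewrite lee_fin.
  - exact/measurable_EFinP.
  have -> : ((5 * K)%:E = (5 / 2)%:E * (K%:E + K%:E))%E.
    by rewrite -EFinD -EFinM; congr EFin; field.
  by rewrite lee_wpmul2l ?lee_fin//; apply: leeD; exact: step_layer_mass.
apply: le_trans (leeD (lexx _) LM).
rewrite !energyE// -!ge0_integralD//; last 5 first.
- by move=> x _; rewrite lee_fin energy_density_ge0.
- by move=> x _; rewrite lee_fin mulr_ge0// addr_ge0.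
- apply/measurable_EFinP; apply: measurable_funM => //; exact: measurable_funD.
- by move=> x _; rewrite lee_fin energy_density_ge0.
- by move=> x _; rewrite lee_fin.
apply: ae_ge0_le_integral => //.
- by move=> x _; rewrite -EFinD lee_fin addr_ge0// energy_density_ge0.
- exact: emeasurable_funD.
- by move=> x _; rewrite -EFinD lee_fin addr_ge0 ?energy_density_ge0 ?mulr_ge0 ?addr_ge0.
- apply: emeasurable_funD => //.
  apply/measurable_EFinP; apply: measurable_funM => //; exact: measurable_funD.
apply: filterS3 wu vu (sqr_nablaE mu_fin vG) => x /andP[w0x w1x] /andP[v0x v1x] nv _.
rewrite -!EFinD lee_fin /energy_density nv.
rewrite (ger0_norm (mulr_ge0 v0x _)) ?subr_ge0// (ger0_norm (mulr_ge0 w0x _)) ?subr_ge0//.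
rewrite big_ord_recl [sqr_nabla w x]big_ord_recl.
rewrite (_ : \sum_(i < m) G (lift ord0 i) x ^+ 2 =
    (1 - slab_bump a b (x 0 ord0)) ^+ 2 * \sum_(i < m) nabla w (lift ord0 i) x ^+ 2); last first.
  rewrite mulr_sumr; apply: eq_bigr => i _.
  by rewrite GE mul0r mul0r subr0 exprMn.
rewrite GE eqxx mul1r.
apply: cutoff_density_le => //; first exact: sigmoid_step_gt0.
- exact: sigmoid_step_le.
- exact: sigmoid_step_lt1.
- by rewrite w0x.
- by apply: sumr_ge0 => i _; rewrite sqr_ge0.
Qed.

(** If w is optimal up to C among its neighbours, then what the competitor saves
is bounded by C plus the cost of its two transition layers. *)
Lemma slab_energy_le a b (w : L2) (delta C : R) : a <= b -> K * (b - a) <= delta ->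
  H1 w -> unit_valued w ->
  (forall v : L2, H1 v -> unit_valued v -> L2norm (v - w) ^+ 2 <= delta ->
    (energy eps w <= energy eps v + C%:E)%E) ->
  (\int[mu]_x (slab_bump a b (x 0%R ord0) / 2 * energy_density eps w x)%:E
    <= (C + 5 * K)%:E)%E.
Proof.
move=> ab abdelta w1 wu wopt.
have [v [v1 vu vw]] := cutoff_competitor ab w1 wu.
have := wopt v v1 vu (le_trans vw abdelta).
have := energy_fin mu_fin eps_gt0 v1 vu; have := energy_fin mu_fin eps_gt0 w1 wu.
case: (energy eps w) => // Ew _; case: (energy eps v) => // Ev _.
case: (integral _ _ _) => [I| |]; last by move=> _ _; rewrite leNye.
  by rewrite -!EFinD !lee_fin; lra.
by rewrite addey// -EFinD leye_eq.
Qed.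

(** The interval [-L - 1, L] is divided into N slabs and the corresponding bumps
telescope to a single one, with a step up at -L - 1 and a step down at L.  For
|x_0| <= L the first step is at least sigmoid eps^-1, thanks to the margin 1,
and the second one is at most 1 / 2. *)
Lemma sum_slab_energy_le (w : L2) (delta C : R) (N : nat) :
  (0 < N)%N -> K * ((2 * L + 1) / N%:R) <= delta ->
  H1 w -> unit_valued w ->
  (forall v : L2, H1 v -> unit_valued v -> L2norm (v - w) ^+ 2 <= delta ->
    (energy eps w <= energy eps v + C%:E)%E) ->
  (((sigmoid eps^-1 - 2^-1) / 2)%:E * energy eps w <= (N%:R * (C + 5 * K))%:E)%E.
Proof.
move=> N0 Ndelta w1 wu wopt.
have p0 : 0 < eps^-1 by rewrite invr_gt0.
have NR0 : 0 < N%:R :> R by rewrite ltr0n.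
pose h : R := (2 * L + 1) / N%:R.
have h0 : 0 < h by rewrite divr_gt0// addr_gt0// mulr_gt0.
pose a (k : nat) : R := - L - 1 + k%:R * h.
have ak k : a k <= a k.+1 by rewrite /a lerD2l ler_wpM2r ?ler_nat ?(ltW h0).
have aS k : a k.+1 - a k = h by rewrite /a -natr1; ring.
have a0 : a 0%N = - L - 1 by rewrite /a mul0r addr0.
have aN : a N = L by rewrite /a /h mulrC divfK ?gt_eqF//; ring.
have c0 : 0 < sigmoid eps^-1 - 2^-1 by rewrite subr_gt0 sigmoid_gt_half.
pose I k := (\int[mu]_x
  (slab_bump (a k) (a k.+1) (x 0%R ord0) / 2 * energy_density eps w x)%:E)%E.
have IC k : (I k <= (C + 5 * K)%:E)%E.
  by apply: (slab_energy_le (ak k) _ w1 wu wopt); rewrite aS.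
have tk0 k (x : 'rV[R]_d) :
    0 <= slab_bump (a k) (a k.+1) (x 0 ord0) / 2 * energy_density eps w x.
  by rewrite mulr_ge0 ?energy_density_ge0// divr_ge0// slab_bump_ge0.
have mdw := measurable_int mu (integrable_energy_density mu_fin eps w).
have mt k : measurable_fun setT
    (fun x : 'rV[R]_d => slab_bump (a k) (a k.+1) (x 0 ord0) / 2 * energy_density eps w x).
  apply: measurable_funM; last exact/measurable_EFinP.
  apply: measurable_funM => //; apply: measurable_funB;
    apply: continuous_measurable_rV; apply: smooth_continuous; exact: smooth_sigmoid_step.
apply: (@le_trans _ _ (\sum_(k <- iota 0 N) I k)%E); last first.
  apply: (@le_trans _ _ (\sum_(k <- iota 0 N) (C + 5 * K)%:E)%E).
    by apply: lee_sum => k _; exact: IC.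
  have sumC : \sum_(k <- iota 0 N) (C + 5 * K) = N%:R * (C + 5 * K).
    by rewrite big_const_seq count_predT size_iota iter_addr_0 [RHS]mulr_natl.
  by rewrite sumEFin sumC.
rewrite /I -ge0_integral_sum//; last 2 first.
- by move=> k; exact/measurable_EFinP.
- by move=> k x _; rewrite lee_fin.
rewrite energyE// -ge0_integralZl//; last 2 first.
- by move=> x _; rewrite lee_fin energy_density_ge0.
- by rewrite lee_fin divr_ge0// ltW.
apply: ae_ge0_le_integral => //.
- move=> x _; rewrite -EFinM lee_fin mulr_ge0 ?energy_density_ge0//.
  by rewrite divr_ge0// ltW.
- exact: emeasurable_funM.
- by move=> x _; apply: sume_ge0 => k _; rewrite lee_fin.
- by apply: emeasurable_sum => k; exact/measurable_EFinP.
have := leb_on_ae oOmega; apply: filterS => x Ox _.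
rewrite sumEFin -EFinM lee_fin -mulr_suml ler_wpM2r ?energy_density_ge0//.
rewrite -mulr_suml ler_wpM2r//.
have -> : \sum_(k <- iota 0 N) slab_bump (a k) (a k.+1) (x 0 ord0) =
    sigmoid_step eps (- L - 1) (x 0 ord0) - sigmoid_step eps L (x 0 ord0).
  rewrite -a0 -aN -[RHS]opprB -(telescope_sumr (fun k => sigmoid_step eps (a k) (x 0 ord0)))//.
  by rewrite -sumrN /index_iota subn0; apply: eq_bigr => k _; rewrite opprB.
have := OmegaL Ox ord0; rewrite ler_norml => /andP[x1 x2].
apply: lerB.
  apply: sigmoid_le; rewrite -mulrBr -[leLHS]mulr1 ler_wpM2l ?(ltW p0)//; lra.
rewrite -(@sigmoid0 R); apply: sigmoid_le.
by rewrite -mulrBr pmulr_rle0//; lra.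
Qed.

End cutoff.

(** The number of slabs depends only on Omega and delta, and the lower bound
sigmoid eps^-1 - 1 / 2 for the sum of the bumps is a decreasing function of eps,
so that its value at eps0 serves for all eps <= eps0. *)
Lemma energy_bound (R : realType) (m : nat) (Omega : set 'rV[R]_m.+1)
    (oOmega : open Omega) (delta eps0 C : R) :
  bounded_set Omega -> 0 < delta -> 0 < eps0 -> 0 <= C ->
  exists B : R, forall (eps : R) (w : L2 oOmega), 0 < eps <= eps0 ->
    H1 w -> unit_valued w ->
    (forall v : L2 oOmega, H1 v -> unit_valued v -> L2norm (v - w) ^+ 2 <= delta ->
      (energy eps w <= energy eps v + C%:E)%E) ->
    (energy eps w <= B%:E)%E.
Proof.
move=> bO delta0 eps00 C0; have mufin := leb_on_fin oOmega bO.
have [M [_ OM]] := bO; pose L : R := `|M + 1| + 1.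
have L0 : 0 < L by rewrite /L ltr_wpDl.
have OL x : Omega x -> forall i, `|x 0 i| <= L.
  move=> Ox i; apply: le_trans (norm_coord_le _ _) _.
  apply: (@le_trans _ _ (M + 1)); first by apply: OM Ox; rewrite ltrDl.
  by apply: le_trans (ler_norm _) _; rewrite lerDl.
pose K := (2 * L) ^+ m.
pose N := (Num.bound (K * (2 * L + 1) / delta)).+1.
have K0 : 0 <= K by rewrite exprn_ge0// mulr_ge0// ltW.
have NP : K * ((2 * L + 1) / N%:R) <= delta.
  rewrite mulrA ler_pdivrMr ?ltr0n// -ler_pdivrMl// mulrC.
  have q0 : 0 <= K * (2 * L + 1) / delta.
    by rewrite divr_ge0 ?(ltW delta0)// mulr_ge0// addr_ge0// mulr_ge0// ltW.
  apply: le_trans (ltW (archi_boundP q0)) _.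
  by rewrite ler_nat.
have c0 : 0 < (sigmoid eps0^-1 - 2^-1) / 2.
  by rewrite divr_gt0// subr_gt0 sigmoid_gt_half// invr_gt0.
exists (N%:R * (C + 5 * K) / ((sigmoid eps0^-1 - 2^-1) / 2)).
move=> eps w /andP[e0 ee0] w1 wu wopt.
have := sum_slab_energy_le L0 OL mufin e0 (ltn0Sn _) NP w1 wu wopt.
have := energy_ge0 mufin e0 w1 wu; have := energy_fin mufin e0 w1 wu.
case: (energy eps w) => // E _; rewrite -EFinM !lee_fin => E0 h.
rewrite ler_pdivlMr// mulrC; apply: le_trans h.
rewrite ler_wpM2r// ler_wpM2r// lerD2r; apply: sigmoid_le.
by rewrite lef_pV2.
Qed.

(** * Rejected trial steps *)

Section subproblem.
Variables (R : realType) (d : nat) (Omega : set 'rV[R]_d) (oOmega : open Omega).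
Local Notation mu := (leb_on oOmega).
Local Notation L2 := (L2 oOmega).
Hypothesis mu_fin : (mu setT < +oo)%E.

Lemma unit_valued_Linf (w : L2) : unit_valued w ->
  ('N[mu]_+oo[EFin \o w] <= 1)%E.
Proof.
move=> wu; rewrite unlock; case: ifP => _; last by rewrite lee01.
apply/ess_sup_inf.ess_supP; apply: filterS wu => x /andP[w0 w1].
by rewrite /= lee_fin ger0_norm.
Qed.

Lemma L2norm0 : L2norm (0 : L2) = 0.
Proof.
have : L2norm (0 : L2) ^+ 2 = 0.
  apply/EFin_inj; rewrite L2norm_sqr; apply: integral0_eq => x _.
  by rewrite expr0n.
by move=> /eqP; rewrite sqrf_eq0 => /eqP.
Qed.

Lemma inner_le (g h : L2) : `|inner oOmega g h| <= (L2norm g ^+ 2 + L2norm h ^+ 2) / 2.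
Proof.
have gi := L2_sqr_integrable g; have hi := L2_sqr_integrable h.
have ghi := L2_mul_integrable g h.
have sumi : mu.-integrable setT (EFin \o (fun x => g x ^+ 2 + h x ^+ 2)).
  exact: (integrableD measurableT gi hi).
apply: (@le_trans _ _ (\int[mu]_x (2^-1 * (g x ^+ 2 + h x ^+ 2)))).
  apply: le_trans (le_normr_Rintegral measurableT ghi) _.
  apply: le_Rintegral => //.
  - exact: integrable_norm ghi.
  - exact: (integrableZl measurableT 2^-1 sumi).
  - move=> x _; rewrite normrM -[g x ^+ 2]real_normK ?num_real//.
    rewrite -[h x ^+ 2]real_normK ?num_real//.
    have := sqr_ge0 (`|g x| - `|h x|); nra.
rewrite RintegralZl//.
rewrite RintegralD// mulrC le_eqVlt; apply/orP; left; apply/eqP.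
by congr ((_ + _) / 2); apply/EFin_inj; rewrite L2norm_sqr /Rintegral fineK//;
  exact: integrable_fin_num.
Qed.

Variables (gamma : R) (gamma_gt0 : 0 < gamma) (j : L2 -> R) (gradj : L2 -> L2).
Variables (eps : R) (eps_gt0 : 0 < eps).

Lemma minimizer_H1 (w wt g : L2) (Delta : R) : 0 <= Delta -> H1 w -> unit_valued w ->
  minimizer gamma false eps w g Delta wt -> H1 wt.
Proof.
move=> D0 w1 wu [_ wtmin]; apply: contrapT => nwt.
have : feasible w Delta w by split => //; rewrite subrr L2norm0 expr0n.
move=> /wtmin; rewrite /= /TR_objective.
have -> : energy eps wt = +oo%E by rewrite /energy memNset.
have := energy_fin mu_fin eps_gt0 w1 wu; case: (energy eps w) => // E _.
by rewrite gt0_muley ?lte_fin// addey// addye// -EFinM -!EFinD leye_eq.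
Qed.

Variables (rho kmin A Mj : R).
Hypothesis rho_itv : 0 < rho < 1.
Hypothesis j_le : forall w : L2, unit_valued w -> `|j w| <= Mj.

(** The trial point wt is optimal, so energy eps wt <= energy eps v up to the
linear terms.  A rejection gives energy eps w <= energy eps wt up to constants:
either the actual reduction is at most kmin, or it is less than rho times the
predicted one; in the second case both are gamma * (energy eps w - energy eps wt)
up to bounded terms, and rho < 1 allows to solve for this difference. *)
Lemma rejected_energy_le (w wt : L2) (Delta : R) :
  0 <= Delta -> H1 w -> unit_valued w ->
  (L2norm (gradj w) ^+ 2 + Delta) / 2 <= A ->
  minimizer gamma false eps w (gradj w) Delta wt ->
  ~~ ((rho%:E * pred_red gamma gradj false w Delta eps <= act_red gamma j w wt eps) &&
      (kmin%:E < act_red gamma j w wt eps))%E ->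
  forall v : L2, H1 v -> unit_valued v -> L2norm (v - w) ^+ 2 <= Delta ->
    (energy eps w <= energy eps v +
      (gamma^-1 * (2 * A + (2 * Mj + A) / (1 - rho) + (2 * Mj + `|kmin|)))%:E)%E.
Proof.
move=> D0 w1 wu gA wtmin rej v v1 vu vw.
have wt1 := minimizer_H1 D0 w1 wu wtmin.
have [[wtw wtu] wtm] := wtmin.
have fv : feasible w Delta v by [].
have /andP[rho0 rho1] := rho_itv.
have Mj0 : 0 <= Mj by exact: le_trans (j_le wu).
have A0 : 0 <= A by apply: le_trans gA; rewrite divr_ge0// addr_ge0 ?sqr_ge0.
have iA (u : L2) : L2norm (u - w) ^+ 2 <= Delta -> `|inner oOmega (gradj w) (u - w)| <= A.
  move=> uD; apply: le_trans (inner_le _ _) (le_trans _ gA).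
  by rewrite ler_wpM2r// lerD2l.
have jw := j_le wu; have jt := j_le wtu.
have predE : pred_red gamma gradj false w Delta eps =
    (- TR_objective gamma eps w (gradj w) wt)%E.
  congr (- _)%E; apply/eqP; rewrite eq_le; apply/andP; split.
    by apply: ereal_inf_lbound; exists wt.
  by apply: le_ereal_inf_tmp => _ [u fu <-]; exact: wtm.
have := wtm v fv; move: rej; rewrite predE /= /TR_objective /act_red.
have := energy_fin mu_fin eps_gt0 v1 vu; have := energy_fin mu_fin eps_gt0 wt1 wtu.
have := energy_fin mu_fin eps_gt0 w1 wu.
case: (energy eps w) => // E _; case: (energy eps wt) => // Et _.
case: (energy eps v) => // Ev _.
have := iA v vw; have := iA wt wtw.
move: (inner _ _ (wt - w)) (inner _ _ (v - w)) => it iv hit hiv.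
rewrite -!EFinM -!EFinB -!EFinD !lee_fin lte_fin.
move: hit hiv jw jt; rewrite !ler_norml.
move=> /andP[it1 it2] /andP[iv1 iv2] /andP[jw1 jw2] /andP[jt1 jt2] rej opt.
have r1 : 0 < 1 - rho by rewrite subr_gt0.
have q0 : 0 <= (2 * Mj + A) / (1 - rho) by rewrite divr_ge0 ?(ltW r1)// addr_ge0// mulr_ge0.
have k0 := normr_ge0 kmin; have k1 := ler_norm kmin.
have key : gamma * E <= gamma * Et + (2 * Mj + A) / (1 - rho) + (2 * Mj + `|kmin|).
  move: rej; rewrite negb_and -!leNgt -!ltNge => /orP[rej|rej]; last by lra.
  have : (1 - rho) * (gamma * (E - Et)) <= 2 * Mj + A by nra.
  rewrite mulrC -ler_pdivlMr// mulrBr; lra.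
rewrite -(ler_pM2l gamma_gt0) mulrDr mulrA divff ?gt_eqF// mul1r.
lra.
Qed.

End subproblem.

(** * Iterates of bounded energy *)

Lemma unbounded_subsequence (P : nat -> Prop) :
  (forall N, exists2 n, (N <= n)%N & P n) ->
  exists2 phi : nat -> nat, {homo phi : m n / (m < n)%N} & forall k, P (phi k).
Proof.
move=> inf; have /choice[next nextP] : forall N, exists n, (N <= n)%N /\ P n.
  by move=> N; have [n Nn Pn] := inf N; exists n.
pose phi := fix phi k := if k is k'.+1 then next (phi k').+1 else next 0%N.
exists phi; last by case=> [|k]; exact: (nextP _).2.
apply: (homo_ltn ltn_trans) => k.
by have [] := nextP (phi k).+1.
Qed.

Theorem proposition4p6 (R : realType) (d : nat) (hd : d = 2%N \/ d = 3%N)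
  (Omega : set 'rV[R]_d) (oOmega : open Omega)
  (hOmega : bounded_lipschitz_domain Omega) (cOmega : convex_set Omega)
  (gamma : R) (gamma_gt0 : 0 < gamma)
  (j : L2 oOmega -> R) (gradj : L2 oOmega -> L2 oOmega)
  (hj : forall w, exists2 A : L2 oOmega -> R,
     frechet_derivative j w A & riesz_representative A (gradj w))
  (j_bounded : bounded_on_Linf_ball j)
  (gradj_bounded : bounded_on_Linf_ball (fun w => L2norm (gradj w)))
  (rho Delta0 eps0 r kappa0 minDelta0 : R)
  (hrho : 0 < rho < 1) (hDelta0 : 0 < Delta0) (heps0 : 0 < eps0) (hr : 4 < r)
  (hkappa0 : 0 < kappa0 < rho) (hminDelta0 : 0 < minDelta0 < Delta0)
  (w0 : L2 oOmega) (w0_H1 : H1 w0) (w0_binary : binary_valued w0)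
  (s : nat -> state oOmega)
  (hs : homotopy_TR_run gamma j gradj rho Delta0 r eps0 kappa0 minDelta0 w0 s)
  (s_H1 : forall n, H1 (iterate (s n)))
  (s_unit : forall n, unit_valued (iterate (s n))) :
  exists C : R, 0 < C /\
    exists phi : nat -> nat, {homo phi : m n / (m < n)%N} /\
      (ereal_sup [set (j (iterate (s (phi k))))%:E
                      + gamma%:E * energy (epsilon (s (phi k)))
                                          (iterate (s (phi k)))
                 | k in [set: nat]] < C%:E)%E.
Proof.
have [_ _ _ bO _] := hOmega; have mufin := leb_on_fin oOmega bO.
have [kappa0_gt0 _] := andP hkappa0; have [minD0 _] := andP hminDelta0.
have [s0 sS] := hs.
have [Mj jM] := j_bounded; have [Mg gM] := gradj_bounded.
have j_le w : unit_valued w -> `|j w| <= Mj.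
  by move=> wu; apply: jM; exact: unit_valued_Linf.
have Mj0 : 0 <= Mj by exact: le_trans (j_le _ (s_unit 0%N)).
have [A A0 g_le] : exists2 A : R, 0 <= A & forall w, unit_valued w ->
    (L2norm (gradj w) ^+ 2 + Delta0) / 2 <= A.
  exists ((Mg ^+ 2 + Delta0) / 2).
    by rewrite divr_ge0// addr_ge0 ?sqr_ge0 ?(ltW hDelta0).
  move=> w wu; have := gM w (unit_valued_Linf wu).
  rewrite ler_norml => /andP[g1 g2].
  by rewrite ler_wpM2r// lerD2r; nra.
have [rho0 rho1] := andP hrho.
(* The constant of [rejected_energy_le], with the acceptance threshold
   kappa * min_radius replaced by its initial value, which is its largest. *)
pose C := gamma^-1 * (2 * A + (2 * Mj + A) / (1 - rho) + (2 * Mj + kappa0 * minDelta0)).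
have C0 : 0 <= C.
  rewrite mulr_ge0 ?invr_ge0 ?(ltW gamma_gt0)// !addr_ge0 ?mulr_ge0//.
  - by rewrite addr_ge0 ?mulr_ge0.
  - by rewrite invr_ge0 subr_ge0 ltW.
  - exact: ltW.
  - exact: ltW.
have {hd}[m dE] : exists m, d = m.+1 by case: hd => ->; [exists 1%N|exists 2%N].
have [B BP] : exists B : R, forall (eps : R) (w : L2 oOmega), 0 < eps <= eps0 ->
    H1 w -> unit_valued w ->
    (forall v : L2 oOmega, H1 v -> unit_valued v -> L2norm (v - w) ^+ 2 <= Delta0 ->
      (energy eps w <= energy eps v + C%:E)%E) ->
    (energy eps w <= B%:E)%E.
  clear -bO hDelta0 heps0 C0 dE; subst d.
  exact: (energy_bound _ bO hDelta0 heps0 C0).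
have par n : [/\ 0 < epsilon (s n) <= eps0, 0 < min_radius (s n) <= minDelta0
    & 0 < kappa (s n) <= kappa0].
  elim: n => [|n [/andP[e1 e2] /andP[d1 d2] /andP[k1 k2]]].
    by rewrite s0/= !lexx heps0 minD0 kappa0_gt0.
  have [wt _ ->] := sS n; rewrite /next_state.
  case: ifP => _; last by split; apply/andP.
  case: ifP => _; first by split; apply/andP.
  have r1 : 1 < r by apply: lt_trans hr; rewrite ltr1n.
  split; apply/andP; rewrite /= divr_gt0 ?(lt_trans _ r1)//; split=> //.
  - rewrite ler_pdivrMr ?(lt_trans _ r1)//; apply: (le_trans e2).
    by rewrite ler_peMr// ?ltW.
  - by rewrite ler_pdivrMr//; lra.
  - by rewrite ler_pdivrMr//; lra.
pose low n := (energy (epsilon (s n)) (iterate (s n)) <= B%:E)%E.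
have rejected_low n wt : flag (s n) = false -> Defs.radius (s n) = Delta0 ->
    minimizer gamma (flag (s n)) (epsilon (s n)) (iterate (s n))
      (gradj (iterate (s n))) (Defs.radius (s n)) wt ->
    accepted gamma j gradj rho (s n) wt = false -> low n.
  move=> fl rad; rewrite /accepted fl rad => wtmin /negbT rej.
  have [en dn kn] := par n; apply: BP => // v v1 vu vw.
  have [e1 _] := andP en.
  apply: le_trans (rejected_energy_le mufin gamma_gt0 e1 hrho j_le (ltW hDelta0)
    (s_H1 n) (s_unit n) (g_le _ (s_unit n)) wtmin rej v1 vu vw) _.
  rewrite leeD2l// lee_fin ler_wpM2l ?invr_ge0 ?(ltW gamma_gt0)// lerD2l lerD2l.
  have [d1 d2] := andP dn; have [k1 k2] := andP kn.
  by rewrite gtr0_norm ?mulr_gt0//; apply: ler_pM => //; exact: ltW.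
(* While flag is false, the radius is still Delta0 until the first rejection;
   this rejection gives a low energy, and neither the iterate nor epsilon
   changes until the flag is set again. *)
have inv n : [\/ flag (s n), Defs.radius (s n) = Delta0 | low n].
  elim: n => [|n IH]; first by rewrite s0; apply: Or31.
  have [wt wtmin sE] := sS n.
  case acc : (accepted gamma j gradj rho (s n) wt).
    rewrite sE /next_state acc /=; case: ifP => _; [exact: Or32|exact: Or31].
  case fl : (flag (s n)).
    rewrite sE /next_state acc fl /=; case: ifP => _; [exact: Or32|exact: Or31].
  have lown : low n.
    by case: IH; rewrite ?fl// => rad; exact: rejected_low rad wtmin acc.
  rewrite sE /next_state acc fl /=; case: ifP => nupd; first exact: Or31.
  by apply: Or33; rewrite /low sE /next_state acc fl /= nupd.
pose J n := ((j (iterate (s n)))%:E + gamma%:E * energy (epsilon (s n)) (iterate (s n)))%E.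
have efin n : energy (epsilon (s n)) (iterate (s n)) \is a fin_num.
  by have [/andP[e1 _] _ _] := par n; exact: energy_fin.
(* Outside low energies: either the step is accepted and the objective drops, or
   nothing changes, since epsilon is decreased only at a low energy. *)
have step n : low n \/ (J n.+1 <= J n)%E.
  have [wt wtmin sE] := sS n.
  case acc : (accepted gamma j gradj rho (s n) wt).
    right.
    have [it ep] : iterate (s n.+1) = wt /\ epsilon (s n.+1) = epsilon (s n).
      by rewrite sE /next_state acc/=; case: ifP.
    have := efin n.+1; have := efin n; rewrite /J it ep.
    move: acc; rewrite /accepted /act_red => /andP[_].
    case: (energy _ (iterate _)) => // E; case: (energy _ wt) => // Et + _ _.
    have [_ /andP[d1 _] /andP[k1 _]] := par n.
    rewrite -!EFinM -!EFinB -!EFinD lte_fin lee_fin => h.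
    have := mulr_gt0 k1 d1; lra.
  have [upd|nupd] := boolP ((Defs.radius (s n) / 2 < min_radius (s n)) && ~~ flag (s n)).
    left; have /andP[_ /negbTE fl] := upd.
    by have := inv n; case; rewrite ?fl// => rad; exact: rejected_low rad wtmin acc.
  have [it ep] : iterate (s n.+1) = iterate (s n) /\ epsilon (s n.+1) = epsilon (s n).
    rewrite sE /next_state acc/=; case: ifP => [h|_]; last by split.
    by case: ifP => [_|fl]; [split|move: nupd; rewrite h fl].
  by right; rewrite /J it ep.
have bounded (phi : nat -> nat) (M : R) : (forall k, (J (phi k) <= M%:E)%E) ->
    (ereal_sup [set J (phi k) | k in [set: nat]] < (`|M| + 1)%:E)%E.
  move=> JM; apply: (@le_lt_trans _ _ M%:E); last first.
    by rewrite lte_fin; apply: le_lt_trans (ler_norm _) _; rewrite ltrDl.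
  by apply: ge_ereal_sup => _ [k _ <-].
have [lows|] := pselect (forall N, exists2 n, (N <= n)%N & low n).
  have [phi mono lowphi] := unbounded_subsequence lows.
  exists (`|Mj + gamma * B| + 1); split; first by rewrite ltr_wpDl.
  exists phi; split => //; apply: bounded => k.
  rewrite /J EFinD EFinM; apply: leeD.
    by rewrite lee_fin; apply: le_trans (ler_norm _) (j_le _ _).
  by apply: lee_wpmul2l; [rewrite lee_fin ltW|exact: lowphi].
move=> /existsNP[N nlow].
have nl k : ~ low (N + k)%N.
  by move=> lk; apply: nlow; exists (N + k)%N => //; exact: leq_addr.
exists (`|fine (J N)| + 1); split; first by rewrite ltr_wpDl.
exists (addn N); split; first by move=> a b ab; rewrite ltn_add2l.
apply: bounded; elim=> [|k IH].
  rewrite addn0 fineK// /J; case: (energy _ _) (efin N) => // E _.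
have [/nl[]|le1] := step (N + k)%N; rewrite addnS; exact: (le_trans le1 IH).
Qed.
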